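(* Let $d$ and $\partial$ be uniformly locally finite metrics on $\mathbb{N}$, and let $E$ and $F$ be Banach spaces with $1$-unconditional symmetric bases $\mathcal{E}$ and $\mathcal{F}$, respectively. If $(\mathbb{N},\partial)$ has property A and there is a Banach algebra isomorphism $\Phi:\mathrm{B}_u(d,\mathcal{E})\to\mathrm{B}_u(\partial,\mathcal{F})$ such that $\Phi(\mathrm{B}_u^r(d,\mathcal{E}))=\mathrm{B}_u^r(\partial,\mathcal{F})$, then $(\mathbb{N},d)$ and $(\mathbb{N},\partial)$ are coarsely equivalent.
   Context: All Banach spaces are complex unless said otherwise, and ''basis'' means Schauder basis. For a basis $\mathcal{E}=(e_n)_n$ of $E$, $(e_n^* )_n$ denotes the biorthogonal functionals and $\mathcal{L}(E)$ the bounded operators on $E$. Given a metric $d$ on $\mathbb{N}$, $a\in\mathcal{L}(E)$ is a band operator (with respect to $\mathcal{E}$ and $d$) if there is $r>0$ such that $e_m^*(ae_n)=0$ whenever $d(n,m)>r$. $\mathrm{B}_u[d,\mathcal{E}]$ is the algebra of band operators, and the uniform Roe algebra $\mathrm{B}_u(d,\mathcal{E})$ is its operator-norm closure in $\mathcal{L}(E)$. A Banach algebra isomorphism is a bijective algebra homomorphism that is bounded with bounded inverse. $\mathcal{E}$ is $1$-unconditional if $\|\sum_{n\le k}\alpha_ne_n\|\le\|\sum_{n\le k}\beta_ne_n\|$ for all $k$ and all scalars with $|\alpha_n|\le|\beta_n|$. $\mathcal{E}$ is symmetric if for every bijection $\pi:\mathbb{N}\to\mathbb{N}$ there is $\lambda\ge1$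 with $\lambda^{-1}\|\sum_{n\le k}\alpha_ne_n\|\le\|\sum_{n\le k}\alpha_ne_{\pi(n)}\|\le\lambda\|\sum_{n\le k}\alpha_ne_n\|$ for all $k$ and all scalars. Regular operators: if $\mathcal{E}$ is $1$-unconditional, let $E_{\mathbb{R}}$ be the closed real span of $\mathcal{E}$, a Dedekind complete real Banach lattice under the coordinatewise order; $E$ is its lattice complexification. For $a\in\mathcal{L}(E)$ write $a(x)=a_r(x)+ia_c(x)$ for $x\in E_{\mathbb{R}}$, with $a_r,a_c\in\mathcal{L}(E_{\mathbb{R}})$. The operator $a$ is regular if each of $a_r,a_c$ is a difference of two positive linear maps on $E_{\mathbb{R}}$ (a linear map is positive if it maps vectors with nonnegative coordinates to such vectors). $\mathcal{L}(E)_r$ is the set of regular operators. For $a\in\mathcal{L}(E)_r$ let $|a|=\sup_{t\in[0,2\pi]}|\cos(t)a_r+\sin(t)a_c|$ (supremum in the Dedekind complete lattice of regular operators on $E_{\mathbb{R}}$) and $\|a\|_r=\||a|\|$. If $d$ is uniformly locally finite and $\mathcal{E}$ is $1$-unconditional, every band operator is regular, and the regular uniform Roe algebra $\mathrm{B}_u^r(d,\mathcal{E})$ is the $\|\cdot\|_r$-closure of $\mathrm{B}_u[d,\mathcal{E}]$ in $\mathcal{L}(E)_r$; it is contained in $\mathrm{B}_u(d,\mathcal{E})$. A metric $d$ on $\mathbb{N}$ is uniformly locally finite if $\sup_{x}|B_r(x)|<\infty$ for all $r>0$ ($B_r(x)$ the closed $r$-ball). A $d$-partition of unit is a sequence $(\varphi_n:\mathbb{N}\to[0,1])_{n\in\mathbb{N}}$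 with $\sup_m|\{n:\varphi_n(m)\ne0\}|<\infty$, $\sup_n\mathrm{diam}(\mathrm{supp}(\varphi_n))<\infty$, and $\sum_n\varphi_n(m)^2=1$ for all $m$. It has $(r,\varepsilon)$-variation if $d(k,m)<r$ implies $\sum_n|\varphi_n(k)-\varphi_n(m)|^2<\varepsilon^2$. A uniformly locally finite $(\mathbb{N},d)$ has property A if for all $r,\varepsilon>0$ there is a $d$-partition of unit with $(r,\varepsilon)$-variation. A map $f:(X,d)\to(Y,\partial)$ is coarse if for all $r>0$ there is $s>0$ such that $d(x,y)<r$ implies $\partial(f(x),f(y))<s$; expanding if for all $s>0$ there is $r>0$ such that $d(x,y)>r$ implies $\partial(f(x),f(y))>s$; a coarse embedding if it is both coarse and expanding; a coarse equivalence if moreover $\sup_{y\in Y}\partial(y,f(X))<\infty$. Two spaces are coarsely equivalent if there is a coarse equivalence between them. *)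

(* Defs.v *)
From HB Require Import structures.
From mathcomp Require Import all_boot all_order all_algebra.
From mathcomp Require Import complex.
From mathcomp Require Import all_classical all_reals all_analysis.

Set Implicit Arguments.
Unset Strict Implicit.
Unset Printing Implicit Defensive.

Import Order.TTheory GRing.Theory Num.Theory.
Import numFieldNormedType.Exports.

Local Open Scope classical_set_scope.
Local Open Scope card_scope.
Local Open Scope complex_scope.
Local Open Scope ring_scope.

(** * Coarse geometry of metrics on [nat] *)

Section Coarse.
Context {R : realType}.
Implicit Types (d del : nat -> nat -> R) (f : nat -> nat).

Definition metric_on_nat d : Prop :=
  [/\ forall x y, 0 <= d x y,
      forall x y, d x y = 0 <-> x = y,
      forall x y, d x y = d y x
    & forall x y z, d x z <= d x y + d y z].

Definition uniformly_locally_finite d : Prop :=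
  forall r : R, 0 < r ->
  exists N : nat, forall x, [set y | d x y <= r] #<= `I_N.

Definition partition_of_unit d (phi : nat -> nat -> R) : Prop :=
  [/\ forall n m, 0 <= phi n m <= 1,
      exists N : nat, forall m, [set n | phi n m != 0] #<= `I_N,
      exists D : R, forall n x y, phi n x != 0 -> phi n y != 0 -> d x y <= D
    & forall m, (\sum_(0 <= n <oo) ((phi n m) ^+ 2)%:E)%E = 1%E].

Definition has_variation d (phi : nat -> nat -> R) (r eps : R) : Prop :=
  forall k m, d k m < r ->
  (\sum_(0 <= n <oo) (`|phi n k - phi n m| ^+ 2)%:E < (eps ^+ 2)%:E)%E.

Definition property_A d : Prop :=
  forall r eps : R, 0 < r -> 0 < eps ->
  exists phi, partition_of_unit d phi /\ has_variation d phi r eps.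

Definition coarse_map d del f : Prop :=
  forall r : R, 0 < r ->
  exists2 s : R, 0 < s & forall x y, d x y < r -> del (f x) (f y) < s.

Definition expanding_map d del f : Prop :=
  forall s : R, 0 < s ->
  exists2 r : R, 0 < r & forall x y, r < d x y -> s < del (f x) (f y).

Definition coarse_embedding d del f : Prop :=
  coarse_map d del f /\ expanding_map d del f.

Definition coarse_equivalence d del f : Prop :=
  coarse_embedding d del f /\
  exists D : R, forall y, inf [set del y (f x) | x in [set: nat]] <= D.

Definition coarsely_equivalent d del : Prop :=
  exists f, coarse_equivalence d del f.

End Coarse.

(** * Bases and operators *)

Section Operators.
Context {R : realType} {E : completeNormedModType R[i]}.
Implicit Types (e : nat -> E) (x y : E) (a b T S : E -> E).

Definition expansion e (c : nat -> R[i]) x : Prop :=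
  series (fun n => c n *: e n) @ \oo --> x.

Definition schauder_basis e : Prop :=
  forall x, exists! c : nat -> R[i], expansion e c x.

(* The biorthogonal functional e_n^*; the default value of [xget] is never
   used when [e] is a Schauder basis. *)
Definition biorthogonal e (n : nat) x : R[i] :=
  xget (fun=> 0) [set c | expansion e c x] n.

Definition unconditional1 e : Prop :=
  forall (k : nat) (al be : nat -> R[i]),
  (forall n, (n <= k)%N -> `|al n| <= `|be n|) ->
  `|\sum_(n < k.+1) al n *: e n| <= `|\sum_(n < k.+1) be n *: e n|.

Definition symmetric_basis e : Prop :=
  forall pi : nat -> nat, bijective pi ->
  exists2 lam : R, 1 <= lam &
  forall (k : nat) (al : nat -> R[i]),
    lam^-1%:C * `|\sum_(n < k.+1) al n *: e n|
      <= `|\sum_(n < k.+1) al n *: e (pi n)|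
      <= lam%:C * `|\sum_(n < k.+1) al n *: e n|.

(* Norms on [E] take values in [R[i]]; this is the norm as an element of
   [R]. *)
Definition rnorm x : R := complex.Re `|x|.

Definition bounded_operator a : Prop := linear a /\ continuous a.

(* The norm of the restriction of [T] to the (real or complex) subspace
   [A] of [E]. *)
Definition opnorm_on (A : set E) T : R :=
  sup [set rnorm (T x) | x in A `&` [set x | rnorm x <= 1]].

Definition opnorm a : R := opnorm_on setT a.

Definition band_operator (d : nat -> nat -> R) e a : Prop :=
  bounded_operator a /\
  exists2 r : R, 0 < r & forall n m, r < d n m ->
    biorthogonal e m (a (e n)) = 0.

Definition uniform_roe (d : nat -> nat -> R) e : set (E -> E) :=
  [set a | bounded_operator a /\
    forall eps : R, 0 < eps ->
    exists2 b, band_operator d e b & opnorm (a - b) < eps].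

(** ** Regular operators *)

Definition real_span e : set E :=
  closure [set x | exists (k : nat) (c : nat -> R),
                     x = \sum_(n < k) (c n)%:C *: e n].

(* In [R[i]], [0 <= z] means that [z] is real and nonnegative. *)
Definition positive_cone e : set E :=
  real_span e `&` [set x | forall n, 0 <= biorthogonal e n x].

(* Operators on the real Banach space [real_span e] are represented by
   functions [E -> E] of which only the values on [real_span e] matter. *)
Definition real_operator e T : Prop :=
  (forall x, real_span e x -> real_span e (T x)) /\
  (forall (c : R) x y, real_span e x -> real_span e y ->
     T (c%:C *: x + y) = c%:C *: T x + T y).

Definition positive_operator e T : Prop :=
  real_operator e T /\
  (forall x, positive_cone e x -> positive_cone e (T x)).

Definition regular_real e T : Prop :=
  real_operator e T /\
  exists S1 S2, [/\ positive_operator e S1, positive_operator e S2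
    & forall x, real_span e x -> T x = S1 x - S2 x].

Definition operator_le e S T : Prop :=
  forall x, positive_cone e x -> positive_cone e (T x - S x).

Definition is_operator_sup e (A : set (E -> E)) S : Prop :=
  [/\ regular_real e S,
      forall T, A T -> operator_le e T S
    & forall S', regular_real e S' ->
        (forall T, A T -> operator_le e T S') -> operator_le e S S'].

(* Suprema exist for the bounded families used below and are unique up to
   their values outside [real_span e]. *)
Definition operator_sup e (A : set (E -> E)) : E -> E :=
  xget 0 [set S | is_operator_sup e A S].

(* |T| = T \/ -T in the lattice of regular operators. *)
Definition operator_abs e T : E -> E := operator_sup e [set T; - T].

Definition re_part e y : E :=
  xget 0 [set u | real_span e u /\
                  exists2 v, real_span e v & y = u + 'i *: v].

Definition im_part e y : E :=
  xget 0 [set v | real_span e v /\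
                  exists2 u, real_span e u & y = u + 'i *: v].

(* [re_part e \o a] and [im_part e \o a] are a_r and a_c on [real_span e]. *)
Definition regular_operator e a : Prop :=
  [/\ bounded_operator a,
      regular_real e (re_part e \o a) & regular_real e (im_part e \o a)].

Definition modulus e a : E -> E :=
  operator_sup e
    [set operator_abs e (fun x => (cos t)%:C *: re_part e (a x)
                                    + (sin t)%:C *: im_part e (a x))
    | t in [set t : R | 0 <= t <= 2 * pi]].

Definition regular_norm e a : R := opnorm_on (real_span e) (modulus e a).

Definition regular_roe (d : nat -> nat -> R) e : set (E -> E) :=
  [set a | regular_operator e a /\
    forall eps : R, 0 < eps ->
    exists2 b, band_operator d e b & regular_norm e (a - b) < eps].

End Operators.

(* The algebras are given as sets of operators, with the pointwise linear
   structure of functions and composition as product. *)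
Definition banach_algebra_isomorphism (R : realType)
    (E F : completeNormedModType R[i])
    (A : set (E -> E)) (B : set (F -> F)) (Phi : (E -> E) -> (F -> F)) : Prop :=
  [/\ set_bij A B Phi,
      forall (c : R[i]) a b, A a -> A b ->
        Phi (c *: a + b) = c *: Phi a + Phi b,
      forall a b, A a -> A b -> Phi (a \o b) = Phi a \o Phi b
    & exists M : R, forall a, A a ->
        opnorm (Phi a) <= M * opnorm a /\ opnorm a <= M * opnorm (Phi a)].

(* Main.v *)
(** Both algebras contain all rank-one operators [x |-> x_n *: y], so the
    isomorphism is implemented by a linear isomorphism [U : E -> F] with inverse
    [V].  Put [u m n = f_m^* (U e_n)] and [v n l = e_n^* (V f_l)]; the image of the
    matrix unit [e_{n n'}] has entries [u m n * v n' l].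

    A gliding hump, applied to sums of matrix units along partial translations,
    shows that [u m n * v n' l] is small when [d n n'] is bounded and [del m l] is
    large; this yields coarseness of any map [h] with [v n (h n)] bounded below.

    Such an [h] exists by property A.  Otherwise the image [a] of a diagonal
    projection of infinite rank has entries tending to zero at infinity.  As [a]
    lies in the regular algebra, Schur multiplication by the kernel
    [k m l = \sum_n phi n m * phi n l] of a partition of unit approximates [a] in
    norm by a band operator with entries tending to zero, i.e. [a] is almost
    supported on finitely many columns; this is impossible for an idempotent of
    infinite rank.  Regularity is what bounds the Schur multiplier.

    Finally property A pulls back along the coarse embedding [h], and the same
    argument for [V] in place of [U] shows that [h] is coarsely onto. *)

Require Import Defs.
From HB Require Import structures.
From mathcomp Require Import all_boot all_order all_algebra.
From mathcomp Require Import complex.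
From mathcomp Require Import all_classical all_reals all_analysis.
From mathcomp Require Import ring lra.

Set Implicit Arguments.
Unset Strict Implicit.
Unset Printing Implicit Defensive.

Import Order.TTheory GRing.Theory Num.Theory.
Import numFieldNormedType.Exports.

Local Open Scope classical_set_scope.
Local Open Scope card_scope.
Local Open Scope complex_scope.
Local Open Scope ring_scope.

(** * Real-valued norms over the complex numbers *)

(** Only the products [u m n * v n' l] are entries of elements of a Roe algebra, so the estimates
    are about them. A lower bound on a product passes to its two factors, both being bounded, and
    factors with different indices may then be recombined: a large [u m n] and a large [v n' l] with
    [n], [n'] close force [m], [l] to be close.

    Symmetry of the bases enters by making band matrices with bounded entries into bounded
    operators. Its constant depends on the permutation, so a band is cut into finitely many partial
    permutations chosen from the metric alone; the norm is then at most the largest entry times a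
    constant of the width. The gliding hump uses this to realize its partial translation, and the
    argument with property A uses it to turn small entries into small norm.

    Infinite rank enters through linear algebra: among [L.+1] independent vectors of the range, some
    nontrivial combination has its first [L] coordinates equal to zero. The idempotent fixes this
    vector and would also have to halve its norm. *)

Section ComplexModulus.
Context {R : realType}.
Implicit Types z w : R[i].

(** Norms over [R[i]] are elements of [R[i]], whose order is partial; with values in [R], estimates
    come within reach of [lra]. *)
Definition cabs z : R := complex.Re `|z|.

Lemma cabsE z : `|z| = (cabs z)%:C.
Proof. by rewrite /cabs normc_def. Qed.

Lemma cabs_ge0 z : 0 <= cabs z.
Proof. by rewrite -lecR -cabsE normr_ge0. Qed.

Lemma cabsM z w : cabs (z * w) = cabs z * cabs w.
Proof. by apply: complexI; rewrite rmorphM /= -!cabsE normrM. Qed.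

Lemma cabsD z w : cabs (z + w) <= cabs z + cabs w.
Proof. by rewrite -lecR rmorphD /= -!cabsE ler_normD. Qed.

Lemma cabsN z : cabs (- z) = cabs z.
Proof. by rewrite /cabs normrN. Qed.

Lemma cabs0 : cabs 0 = 0. Proof. by rewrite /cabs normr0. Qed.

Lemma cabs1 : cabs 1 = 1. Proof. by rewrite /cabs normr1. Qed.

Lemma cabs_eq0 z : (cabs z == 0) = (z == 0).
Proof. by rewrite -[z == 0]normr_eq0 cabsE -(inj_eq (@complexI R)). Qed.

Lemma cabsV z : cabs z^-1 = (cabs z)^-1.
Proof. by apply: complexI; rewrite -cabsE normfV cabsE fmorphV. Qed.

Lemma cabsR (x : R) : cabs x%:C = `|x|.
Proof. by apply: complexI; rewrite -cabsE normc_def /= expr0n addr0 sqrtr_sqr. Qed.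

Lemma cabs_Re z : `|complex.Re z| <= cabs z.
Proof.
rewrite -sqrtr_sqr /cabs normc_def /=; apply: ler_wsqrtr.
by rewrite lerDl sqr_ge0.
Qed.

Lemma cabs_Im z : `|complex.Im z| <= cabs z.
Proof.
rewrite -sqrtr_sqr /cabs normc_def /=; apply: ler_wsqrtr.
by rewrite lerDr sqr_ge0.
Qed.

Lemma cabs_le_ReIm z : cabs z <= `|complex.Re z| + `|complex.Im z|.
Proof.
rewrite {1}(complexE z); apply: (le_trans (cabsD _ _)).
by rewrite cabsM !cabsR /cabs normc_def /= expr0n expr1n add0r sqrtr1 mul1r.
Qed.

Lemma cabs_sum (I : Type) (r : seq I) (P : pred I) (g : I -> R[i]) :
  cabs (\sum_(i <- r | P i) g i) <= \sum_(i <- r | P i) cabs (g i).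
Proof.
elim/big_rec2: _ => [|i y x _ h]; first by rewrite cabs0.
by apply: (le_trans (cabsD _ _)); rewrite lerD2l.
Qed.

Lemma real_Im0 z : complex.Im z = 0 -> z = (complex.Re z)%:C.
Proof. by case: z => a b /= ->. Qed.

Lemma ReD z w : complex.Re (z + w) = complex.Re z + complex.Re w.
Proof. by case: z w => [a b] [c d]. Qed.
Lemma ImD z w : complex.Im (z + w) = complex.Im z + complex.Im w.
Proof. by case: z w => [a b] [c d]. Qed.
Lemma ReN z : complex.Re (- z) = - complex.Re z.
Proof. by case: z. Qed.
Lemma ImN z : complex.Im (- z) = - complex.Im z.
Proof. by case: z. Qed.
Lemma ReCM (t : R) z : complex.Re (t%:C * z) = t * complex.Re z.
Proof. by case: z => a b /=; rewrite mul0r subr0. Qed.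
Lemma ImCM (t : R) z : complex.Im (t%:C * z) = t * complex.Im z.
Proof. by case: z => a b /=; rewrite mul0r addr0. Qed.
Lemma Re_sum (I : Type) (r : seq I) (P : pred I) (g : I -> R[i]) :
  complex.Re (\sum_(i <- r | P i) g i) = \sum_(i <- r | P i) complex.Re (g i).
Proof. by apply: (big_morph (@complex.Re R) ReD). Qed.
Lemma Im_sum (I : Type) (r : seq I) (P : pred I) (g : I -> R[i]) :
  complex.Im (\sum_(i <- r | P i) g i) = \sum_(i <- r | P i) complex.Im (g i).
Proof. by apply: (big_morph (@complex.Im R) ImD). Qed.

End ComplexModulus.

Section RealNorm.
Context {R : realType} {E : completeNormedModType R[i]}.
Implicit Types (x y : E).

Lemma rnormE x : `|x| = (rnorm x)%:C.
Proof.
have := normr_ge0 x; rewrite /rnorm.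
by case: `|x| => a b /=; rewrite lecE /= => /andP[/eqP -> _].
Qed.

Lemma rnorm_ge0 x : 0 <= rnorm x.
Proof. by rewrite -lecR -rnormE normr_ge0. Qed.

Lemma rnormZ c x : rnorm (c *: x) = cabs c * rnorm x.
Proof. by apply: complexI; rewrite rmorphM /= -cabsE -!rnormE normrZ. Qed.

Lemma rnormD x y : rnorm (x + y) <= rnorm x + rnorm y.
Proof. by rewrite -lecR rmorphD /= -!rnormE ler_normD. Qed.

Lemma rnormN x : rnorm (- x) = rnorm x.
Proof. by rewrite /rnorm normrN. Qed.

Lemma rnormB x y : rnorm (x - y) <= rnorm x + rnorm y.
Proof. by rewrite -(rnormN y) rnormD. Qed.

Lemma rnormC x y : rnorm (x - y) = rnorm (y - x).
Proof. by rewrite -rnormN opprB. Qed.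

Lemma rnorm0 : rnorm (0 : E) = 0. Proof. by rewrite /rnorm normr0. Qed.

Lemma rnorm_eq0 x : (rnorm x == 0) = (x == 0).
Proof. by rewrite -[x == 0]normr_eq0 rnormE -(inj_eq (@complexI R)). Qed.

Lemma rnorm_gt0 x : (0 < rnorm x) = (x != 0).
Proof. by rewrite lt0r rnorm_eq0 rnorm_ge0 andbT. Qed.

Lemma rnorm_sum (I : Type) (r : seq I) (P : pred I) (g : I -> E) :
  rnorm (\sum_(i <- r | P i) g i) <= \sum_(i <- r | P i) rnorm (g i).
Proof.
elim/big_rec2: _ => [|i y x _ h]; first by rewrite rnorm0.
by apply: (le_trans (rnormD _ _)); rewrite lerD2l.
Qed.

Definition tends (u : nat -> E) x : Prop :=
  forall eps : R, 0 < eps ->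
  exists N, forall n, (N <= n)%N -> rnorm (u n - x) < eps.

Lemma complex_gt0 (z : R[i]) : 0 < z -> z = (complex.Re z)%:C /\ 0 < complex.Re z.
Proof.
by move=> h; have := h; rewrite ltcE /= => /andP[/eqP h1 h2]; split=> //;
  apply: real_Im0.
Qed.

Lemma tendsP (u : nat -> E) x : (u @ \oo --> x) <-> tends u x.
Proof.
split=> [/cvgrPdist_lt h eps e0|h].
  have /h [N _ hN] : 0 < eps%:C by rewrite ltcR.
  exists N => n /hN /=; rewrite distrC rnormE ltcR //.
apply/cvgrPdist_lt => z /complex_gt0 [-> /h[N hN]].
by exists N => // n /= /hN; rewrite distrC rnormE ltcR.
Qed.

Lemma tends_cauchy (u : nat -> E) :
  (forall eps : R, 0 < eps ->
    exists N, forall m n, (N <= m)%N -> (N <= n)%N -> rnorm (u m - u n) < eps) ->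
  exists x, tends u x.
Proof.
move=> h; have : cvg (u @ \oo).
  apply/cauchy_cvgP/cauchy_ballP => z /complex_gt0 [-> /h[N hN]].
  exists (u @` [set n | (N <= n)%N], u @` [set n | (N <= n)%N]) => /=.
    by split; exists N => // n hn; exists n.
  move=> [_ _] /= [[m hm <-] [n hn <-]].
  by rewrite -ball_normE /ball_ /= rnormE ltcR; exact: hN.
by move=> h1; exists (lim (u @ \oo)); apply/tendsP.
Qed.

Lemma tends_le (u : nat -> E) x (C : R) :
  tends u x -> (forall n, rnorm (u n) <= C) -> rnorm x <= C.
Proof.
move=> h hu; apply/ler_addgt0Pr => eps /h[N /(_ N (leqnn N)) hN].
have -> : x = u N - (u N - x) by rewrite opprB addrC subrK.
by apply: (le_trans (rnormB _ _)); apply: lerD => //; exact: ltW.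
Qed.

Lemma tendsD (u v : nat -> E) x y :
  tends u x -> tends v y -> tends (fun n => u n + v n) (x + y).
Proof. by move=> /tendsP h1 /tendsP h2; apply/tendsP; apply: cvgD. Qed.

Lemma tendsZ c (u : nat -> E) x :
  tends u x -> tends (fun n => c *: u n) (c *: x).
Proof. by move=> /tendsP h1; apply/tendsP; apply: cvgZr. Qed.

End RealNorm.

(** * Unconditional symmetric bases *)

Section Schauder.
Context {R : realType} {E : completeNormedModType R[i]}.
Variable e : nat -> E.

Definition psum (al : nat -> R[i]) (N : nat) : E :=
  \sum_(0 <= i < N) al i *: e i.

Lemma psumS al N : psum al N.+1 = psum al N + al N *: e N.
Proof. by rewrite /psum big_nat_recr. Qed.

Lemma psum_lin c al be N :
  psum (fun n => c * al n + be n) N = c *: psum al N + psum be N.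
Proof.
rewrite /psum scaler_sumr -big_split /=.
by apply: eq_bigr => i _; rewrite scalerDl scalerA.
Qed.

Lemma psum_cut al n N : (n <= N)%N ->
  psum (fun i => if (n <= i)%N then al i else 0) N = psum al N - psum al n.
Proof.
move=> nN; rewrite /psum (big_cat_nat (leq0n n) nN) //= [X in _ = X - _](big_cat_nat (leq0n n) nN) //=.
rewrite addrAC subrr add0r big_nat_cond big1 ?add0r.
  by apply: eq_big_nat => i /andP[-> _].
by move=> i /andP[/andP[_ +] _]; rewrite ltnNge => /negbTE ->; rewrite scale0r.
Qed.

Lemma psum_head al n N : (n <= N)%N ->
  psum (fun i => if (i < n)%N then al i else 0) N = psum al n.
Proof.
move=> nN; rewrite /psum (big_cat_nat (leq0n n) nN) //= [X in _ + X]big_nat_cond.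
rewrite [X in _ + X]big1 ?addr0.
  by apply: eq_big_nat => i /andP[_ ->].
by move=> i /andP[/andP[+ _] _]; rewrite leqNgt => /negbTE ->; rewrite scale0r.
Qed.

Lemma psum1 n N : psum (fun i => (i == n)%:R) N = if (n < N)%N then e n else 0.
Proof.
elim: N => [|N IH]; first by rewrite /psum big_geq.
rewrite ltnS leq_eqVlt psumS IH [N == n]eq_sym.
case: eqP => [->|_] /=; first by rewrite ltnn add0r scale1r.
by rewrite scale0r addr0.
Qed.

Lemma expansionP c x : expansion e c x <-> tends (psum c) x.
Proof. exact: tendsP. Qed.

Lemma tends_ge (u : nat -> E) x (C : R) N0 :
  tends u x -> (forall n, (N0 <= n)%N -> C <= rnorm (u n)) -> C <= rnorm x.
Proof.
move=> h hu; apply/ler_addgt0Pr => eps /h[N hN].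
set n := maxn N N0; have h1 := hN n (leq_maxl _ _).
apply: (le_trans (hu n (leq_maxr _ _))).
have -> : u n = x + (u n - x) by rewrite addrC subrK.
by apply: (le_trans (rnormD _ _)); rewrite lerD2l ltW.
Qed.

Hypothesis eS : schauder_basis e.
Hypothesis eU : unconditional1 e.

Local Notation bi := (biorthogonal e).

Lemma tends_coords x : tends (psum (bi ^~ x)) x.
Proof.
have [c [h _]] := eS x.
by apply/expansionP; apply: (@xgetPex _ _ [set c | expansion e c x]); exists c.
Qed.

Lemma coords_unique c x : tends (psum c) x -> forall n, bi n x = c n.
Proof.
move=> h n; have [c' [_ hu]] := eS x.
by rewrite -(hu c) ?(hu (bi ^~ x)) //; apply/expansionP => //; exact: tends_coords.
Qed.

Lemma coords_lin n c x y : bi n (c *: x + y) = c * bi n x + bi n y.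
Proof.
apply: (@coords_unique (fun n => c * bi n x + bi n y)).
have := tendsD (tendsZ c (tends_coords x)) (tends_coords y).
by congr (tends _ _); apply/funext => N; rewrite psum_lin.
Qed.

Lemma coords_basis m n : bi m (e n) = (m == n)%:R.
Proof.
apply: (@coords_unique (fun m => (m == n)%:R)) => eps e0.
by exists n.+1 => N h; rewrite psum1 h subrr rnorm0.
Qed.

Lemma basis_neq0 n : e n != 0.
Proof.
apply/eqP => h; have := coords_basis n n; have := coords_lin n (-1) (e n) (e n).
rewrite h scaler0 addr0 mulN1r addNr => -> /eqP.
by rewrite eqxx /= eq_sym oner_eq0.
Qed.

Lemma psum_mono al be N : (forall n, (n < N)%N -> cabs (al n) <= cabs (be n)) ->
  rnorm (psum al N) <= rnorm (psum be N).
Proof.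
case: N => [|N] h; first by rewrite /psum !big_geq.
rewrite -lecR -!rnormE /psum !big_mkord; apply: eU => n nN.
by rewrite !cabsE lecR; apply: h.
Qed.

Lemma psum_le x N : rnorm (psum (bi ^~ x) N) <= rnorm x.
Proof.
apply: (tends_ge (N0 := N) (tends_coords x)) => n Nn.
rewrite -(psum_head _ Nn); apply: psum_mono => i _.
by case: ifP => // _; rewrite cabs0 cabs_ge0.
Qed.

Lemma psum_cauchy x (eps : R) : 0 < eps -> exists N, forall m n,
  (N <= n)%N -> (n <= m)%N ->
  rnorm (psum (fun i => if (n <= i)%N then bi i x else 0) m) < eps.
Proof.
move=> e0; have /(tends_coords x)[N hN] : 0 < eps / 2 by lra.
exists N => m n Nn nm; rewrite psum_cut //.
have h1 := hN _ (leq_trans Nn nm); have h2 := hN _ Nn.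
have -> : psum (bi ^~ x) m - psum (bi ^~ x) n =
  (psum (bi ^~ x) m - x) - (psum (bi ^~ x) n - x).
  by rewrite opprB addrA subrK.
by apply: (le_lt_trans (rnormB _ _)); lra.
Qed.

Lemma cauchy_sym (u : nat -> E) :
  (forall eps : R, 0 < eps -> exists N, forall m n, (N <= n)%N -> (n <= m)%N ->
    rnorm (u m - u n) < eps) -> exists x, tends u x.
Proof.
move=> h; apply: tends_cauchy => eps /h[N hN]; exists N => m n hm hn.
by case/orP: (leq_total m n) => mn; [rewrite rnormC|]; apply: hN.
Qed.

(** The tails of the series of [al] are dominated by those of the expansion of [x], hence Cauchy.
    Every operator given by coordinates below is built from this solidity. *)
Lemma coords_dom al x : (forall n, cabs (al n) <= cabs (bi n x)) ->
  exists y, forall n, bi n y = al n.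
Proof.
move=> h; have [|y hy] := @cauchy_sym (psum al).
  move=> eps e0; have [N hN] := psum_cauchy x e0.
  exists N => m n Nn nm; apply: le_lt_trans (hN m n Nn nm).
  by rewrite -psum_cut //; apply: psum_mono => i _; case: ifP => // _; rewrite cabs0.
by exists y => n; apply: coords_unique hy _.
Qed.

Lemma coords_mono x y : (forall n, cabs (bi n y) <= cabs (bi n x)) ->
  rnorm y <= rnorm x.
Proof.
move=> h; apply: (tends_le (tends_coords y)) => N.
by apply: le_trans (psum_le x N); apply: psum_mono => n _; exact: h.
Qed.

Lemma coords0 n : bi n 0 = 0.
Proof. by have := coords_lin n (-1) 0 0; rewrite scaler0 addr0 mulN1r addNr. Qed.

Lemma coordsZ n c x : bi n (c *: x) = c * bi n x.
Proof. by rewrite -[c *: x]addr0 coords_lin coords0 addr0. Qed.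

Lemma coords_sum (I : Type) (r : seq I) (P : pred I) (g : I -> E) n :
  bi n (\sum_(i <- r | P i) g i) = \sum_(i <- r | P i) bi n (g i).
Proof.
apply: (big_morph (bi n)) => [x y|]; last exact: coords0.
by rewrite -{1}[x]scale1r coords_lin mul1r.
Qed.

Lemma coords_bound n x : cabs (bi n x) * rnorm (e n) <= rnorm x.
Proof.
rewrite -rnormZ; apply: coords_mono => m; rewrite coordsZ coords_basis.
by case: eqP => [->|_]; rewrite ?mulr1 // mulr0 cabs0 cabs_ge0.
Qed.

Hypothesis eP : symmetric_basis e.

Lemma psum_perm pi : bijective pi -> exists2 lam : R, 1 <= lam &
  forall al N,
    rnorm (\sum_(0 <= n < N) al n *: e (pi n)) <= lam * rnorm (psum al N) /\
    rnorm (psum al N) <= lam * rnorm (\sum_(0 <= n < N) al n *: e (pi n)).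
Proof.
move=> /eP[lam lam1 h]; exists lam => // al [|N].
  by rewrite /psum !big_geq // rnorm0 mulr0.
have := h N al; rewrite /psum !big_mkord !rnormE -!rmorphM /= !lecR.
move=> /andP[h1 h2]; split=> //.
by rewrite -ler_pdivrMl //; lra.
Qed.

(** The comparison of [e n] with [e (pi n)] is what later allows normalized coordinates to be
    permuted as well. *)
Lemma basis_perm pi : bijective pi -> exists2 lam : R, 1 <= lam &
  (forall n, rnorm (e n) <= lam * rnorm (e (pi n))) /\
  (forall x, exists2 y, forall n, bi (pi n) y = bi n x & rnorm y <= lam * rnorm x).
Proof.
move=> piB; have [lam lam1 hl] := psum_perm piB; exists lam => //; split.
  move=> n; have [_] := hl (fun i => (i == n)%:R) n.+1.
  rewrite psum1 ltnSn big_nat_recr //= eqxx scale1r big_nat_cond big1 ?add0r //.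
  by move=> i /andP[/andP[_ h] _]; rewrite ltn_eqF // scale0r.
move=> x; pose v N := \sum_(0 <= n < N) bi n x *: e (pi n).
have [|y hy] := @cauchy_sym v.
  move=> eps e0; have e1 : 0 < eps / lam by rewrite divr_gt0 //; lra.
  have [N hN] := psum_cauchy x e1; exists N => m n Nn nm.
  pose al i := if (n <= i)%N then bi i x else 0.
  have -> : v m - v n = \sum_(0 <= n < m) al n *: e (pi n).
    rewrite /v (big_cat_nat (leq0n n) nm) //= [RHS](big_cat_nat (leq0n n) nm) //= addrAC subrr add0r.
    rewrite [X in _ = X + _]big_nat_cond [X in _ = X + _]big1 ?add0r.
      by apply: eq_big_nat => i /andP[h _]; rewrite /al h.
    by move=> i /andP[/andP[_ +] _]; rewrite /al ltnNge => /negbTE ->; rewrite scale0r.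
  apply: (le_lt_trans (hl al m).1); rewrite mulrC -ltr_pdivlMr; last by lra.
  exact: hN.
have piI : injective pi by apply: bij_inj.
exists y; last first.
  apply: (tends_le hy) => N; apply: (le_trans (hl _ N).1).
  by rewrite ler_pM2l ?psum_le //; lra.
move=> n.
(* The coordinate at [pi n] is constant along the partial sums once the index exceeds [n], so the
   limit inherits it. *)
have hv N : (n < N)%N -> bi (pi n) (v N) = bi n x.
  move=> nN; rewrite /v coords_sum (bigD1_seq n) ?mem_index_iota ?iota_uniq //=.
  rewrite coordsZ coords_basis eqxx mulr1 big1 ?addr0 // => i ni.
  by rewrite coordsZ coords_basis (inj_eq piI) eq_sym (negbTE ni) mulr0.
apply/eqP; rewrite -subr_eq0 -cabs_eq0 eq_le cabs_ge0 andbT.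
rewrite -(pmulr_lle0 _ (_ : 0 < rnorm (e (pi n)))) ?rnorm_gt0 ?basis_neq0 //.
apply/ler_addgt0Pr => eps /hy[N hN]; rewrite add0r.
set M := maxn N n.+1; have h1 := hN M (leq_maxl _ _).
rewrite -(hv M (leq_maxr _ _)) -cabsN opprB.
have -> : bi (pi n) (v M) - bi (pi n) y = bi (pi n) (v M - y).
  by rewrite (_ : v M - y = -1 *: y + v M) ?coords_lin ?mulN1r 1?addrC ?scaleN1r.
exact: le_trans (coords_bound _ _) (ltW h1).
Qed.

End Schauder.

(* The basis is normalized once and for all: a symmetric basis is only known to
   be compatible with each single permutation, and [nb], [nc] spare the uniform
   comparison of the norms of the [e n]. *)
HB.lock Definition nb (R : realType) (E : completeNormedModType R[i])
  (e : nat -> E) (n : nat) : E := (rnorm (e n))^-1%:C *: e n.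

HB.lock Definition nc (R : realType) (E : completeNormedModType R[i])
  (e : nat -> E) (n : nat) (x : E) : R[i] :=
  (rnorm (e n))%:C * biorthogonal e n x.

Section NormalizedBasis.
Context {R : realType} {E : completeNormedModType R[i]}.

Definition sym_basis (e : nat -> E) : Prop :=
  [/\ schauder_basis e, unconditional1 e & symmetric_basis e].

Variable e : nat -> E.
Hypothesis He : sym_basis e.

Let eS : schauder_basis e. Proof. by case: He. Qed.
Let eU : unconditional1 e. Proof. by case: He. Qed.
Let eP : symmetric_basis e. Proof. by case: He. Qed.

Lemma rnorm_basis_gt0 n : 0 < rnorm (e n).
Proof. by rewrite rnorm_gt0 basis_neq0. Qed.

Let en0 n : (rnorm (e n))%:C != 0 :> R[i].
Proof. by rewrite -(rmorph0 (real_complex R)) (inj_eq (@complexI R)) gt_eqF ?rnorm_basis_gt0. Qed.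

Lemma ncE n x : biorthogonal e n x = (rnorm (e n))%:C^-1 * nc e n x.
Proof. by rewrite nc.unlock mulKf. Qed.

Lemma nbE n : e n = (rnorm (e n))%:C *: nb e n.
Proof. by rewrite nb.unlock fmorphV scalerA mulfV // scale1r. Qed.

Lemma nc_lin n a x y : nc e n (a *: x + y) = a * nc e n x + nc e n y.
Proof. by rewrite nc.unlock coords_lin // mulrDr mulrCA. Qed.

Lemma nc0 n : nc e n 0 = 0. Proof. by rewrite nc.unlock coords0 // mulr0. Qed.

Lemma ncZ n a x : nc e n (a *: x) = a * nc e n x.
Proof. by rewrite -[a *: x]addr0 nc_lin nc0 addr0. Qed.

Lemma ncD n x y : nc e n (x + y) = nc e n x + nc e n y.
Proof. by rewrite -{1}[x]scale1r nc_lin mul1r. Qed.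

Lemma ncN n x : nc e n (- x) = - nc e n x.
Proof. by rewrite -scaleN1r ncZ mulN1r. Qed.

Lemma ncB n x y : nc e n (x - y) = nc e n x - nc e n y.
Proof. by rewrite ncD ncN. Qed.

Lemma nc_sum (I : Type) (r : seq I) (P : pred I) (g : I -> E) n :
  nc e n (\sum_(i <- r | P i) g i) = \sum_(i <- r | P i) nc e n (g i).
Proof. by apply: (big_morph (nc e n)) => [x y|]; [exact: ncD|exact: nc0]. Qed.

Lemma nb_norm n : rnorm (nb e n) = 1.
Proof.
rewrite nb.unlock rnormZ cabsR ger0_norm ?invr_ge0 ?rnorm_ge0 //.
by rewrite mulVf // gt_eqF // rnorm_basis_gt0.
Qed.

Lemma nc_nb m n : nc e m (nb e n) = (m == n)%:R.
Proof.
rewrite nc.unlock nb.unlock coordsZ // coords_basis // fmorphV.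
by case: eqP => [->|_]; rewrite ?mulr0 // mulr1 mulfV.
Qed.

Lemma cabs_nc n x : cabs (nc e n x) = rnorm (e n) * cabs (biorthogonal e n x).
Proof. by rewrite nc.unlock cabsM cabsR ger0_norm ?rnorm_ge0. Qed.

Lemma nc_le n x : cabs (nc e n x) <= rnorm x.
Proof. by rewrite cabs_nc mulrC coords_bound. Qed.

Lemma nc_expand x : tends (fun N => \sum_(0 <= i < N) nc e i x *: nb e i) x.
Proof.
have := tends_coords eS x; congr (tends _ _); apply/funext => N.
apply: eq_bigr => i _; rewrite {1}nbE scalerA ncE.
by rewrite mulrAC mulVf // mul1r.
Qed.

Lemma nc_mono x y : (forall n, cabs (nc e n y) <= cabs (nc e n x)) ->
  rnorm y <= rnorm x.
Proof.
move=> h; apply: (coords_mono eS eU) => n; have := h n.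
by rewrite !cabs_nc ler_pM2l ?rnorm_basis_gt0.
Qed.

Lemma nc_dom al x : (forall n, cabs (al n) <= cabs (nc e n x)) ->
  exists y, forall n, nc e n y = al n.
Proof.
move=> h.
have [|y hy] := @coords_dom _ _ _ eS eU (fun n => (rnorm (e n))%:C^-1 * al n) x.
  move=> n; rewrite cabsM cabsV cabsR ger0_norm ?rnorm_ge0 //.
  by rewrite mulrC ler_pdivrMr ?rnorm_basis_gt0 // mulrC -cabs_nc.
by exists y => n; rewrite nc.unlock hy mulVKf.
Qed.

Lemma nc_ext x y : (forall n, nc e n x = nc e n y) -> x = y.
Proof.
move=> h; apply/eqP; rewrite -subr_eq0 -rnorm_eq0 eq_le rnorm_ge0 andbT -(@rnorm0 R E).
by apply: nc_mono => n; rewrite ncB h subrr cabs0 cabs_ge0.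
Qed.

Lemma nc_partial N x n : nc e n (\sum_(0 <= i < N) nc e i x *: nb e i) =
  if (n < N)%N then nc e n x else 0.
Proof.
rewrite nc_sum; case: ltnP => nN.
  rewrite (bigD1_seq n) ?mem_index_iota ?iota_uniq //= ncZ nc_nb eqxx mulr1.
  by rewrite big1 ?addr0 // => i ni; rewrite ncZ nc_nb eq_sym (negbTE ni) mulr0.
rewrite big_nat_cond big1 // => i /andP[/andP[_ h] _].
by rewrite ncZ nc_nb gtn_eqF ?mulr0 // (leq_trans h).
Qed.

Lemma nc_tail x (eps : R) : 0 < eps ->
  exists N, forall n, (N <= n)%N -> cabs (nc e n x) < eps.
Proof.
move=> /(nc_expand x)[N hN]; exists N => n Nn; apply: le_lt_trans (hN N (leqnn N)).
apply: le_trans (nc_le n _).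
by rewrite ncB nc_partial ltnNge Nn /= add0r cabsN.
Qed.

Lemma nc_cvg n (u : nat -> E) x (eps : R) : tends u x -> 0 < eps ->
  exists N, forall k, (N <= k)%N -> cabs (nc e n (u k) - nc e n x) < eps.
Proof.
move=> h /h[N hN]; exists N => k /hN; apply: le_lt_trans.
by rewrite -ncB nc_le.
Qed.

Lemma nc_perm pi : bijective pi -> exists2 lam : R, 0 < lam &
  forall x, exists2 y, forall n, nc e (pi n) y = nc e n x & rnorm y <= lam * rnorm x.
Proof.
move=> piB; have [lam lam1 [hm hp]] := basis_perm eS eU eP piB.
have lam0 : 0 < lam by lra.
exists (lam * lam) => [|x]; first by rewrite mulr_gt0.
(* Permuting raw coordinates changes normalized ones by the ratio of the norms of [e (pi n)] and
   [e n]. The multiplier [q] corrects this; dividing by [lam] makes it at most 1, and [lam] is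
   restored when [hp] is applied to [lam%:C *: x']. *)
pose q n : R := rnorm (e n) / rnorm (e (pi n)) / lam.
have q1 n : cabs ((q n)%:C * nc e n x) <= cabs (nc e n x).
  rewrite cabsM cabsR ler_piMl ?cabs_ge0 // /q.
  rewrite ger0_norm ?mulr_ge0 ?invr_ge0 ?rnorm_ge0 ?(ltW lam0) //.
  by rewrite ler_pdivrMr ?mul1r // ler_pdivrMr ?rnorm_basis_gt0.
have [x' hx'] := nc_dom q1.
have lx' : rnorm x' <= rnorm x by apply: nc_mono => n; rewrite hx'.
have [y hy ly] := hp (lam%:C *: x'); exists y; last first.
  by apply: (le_trans ly); rewrite rnormZ cabsR gtr0_norm // mulrA ler_pM2l // mulr_gt0.
move=> n; rewrite {1}nc.unlock hy coordsZ // ncE hx' /q !rmorphM /= !fmorphV.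
have l0 : lam%:C != 0 :> R[i].
  by rewrite -(rmorph0 (real_complex R)) (inj_eq (@complexI R)) gt_eqF.
have := en0 n; have := en0 (pi n).
by move=> h1 h2; field; rewrite l0 h1 h2.
Qed.

(** Coordinates are continuous, so their reality survives the closure; conversely the partial sums
    of the expansion are real combinations converging to [x]. *)
Lemma real_spanP x : real_span e x <-> forall n, complex.Im (nc e n x) = 0.
Proof.
split=> [h n|h].
  apply/eqP/negPn/negP => hn.
  have e0 : 0 < `|complex.Im (nc e n x)| by rewrite normr_gt0.
  have /h [_ [[k [c ->]]]] : nbhs x (ball x (`|complex.Im (nc e n x)|)%:C).
    by apply: nbhsx_ballx; rewrite ltcR.
  rewrite -ball_normE /ball_ /= rnormE ltcR => hb.
  have := le_lt_trans (le_trans (cabs_Im _) (nc_le n _)) hb.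
  rewrite ncB ImD ImN nc_sum Im_sum big1 ?subr0 ?ltxx // => i _.
  rewrite ncZ ImCM nbE ncZ ImCM nc_nb.
  by case: eqP => _; rewrite !mulr0.
move=> B /nbhs_ballP[z /= /complex_gt0[-> z0] zB].
have [N hN] := nc_expand x z0.
exists (\sum_(0 <= i < N) nc e i x *: nb e i); split.
  exists N, (fun i => complex.Re (nc e i x) / rnorm (e i)).
  rewrite big_mkord; apply: eq_bigr => i _.
  by rewrite nb.unlock scalerA {1}(real_Im0 (h i)) -rmorphM.
by apply: zB; rewrite -ball_normE /ball_ /= distrC rnormE ltcR hN.
Qed.

Lemma positive_coneP x : positive_cone e x <-> forall n, 0 <= nc e n x.
Proof.
have eq n y : (0 <= nc e n y) = (0 <= biorthogonal e n y).
  by rewrite nc.unlock pmulr_rge0 // ltcR rnorm_basis_gt0.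
split=> [[_ h] n|h]; first by rewrite eq; exact: h.
by split=> [|n]; [apply/real_spanP => n; exact: ger0_Im|rewrite -eq].
Qed.

Lemma biorthogonal_eq0 m x : (biorthogonal e m x == 0) = (nc e m x == 0).
Proof. by rewrite nc.unlock mulf_eq0 (negbTE (en0 m)). Qed.

End NormalizedBasis.

(** * Bounded operators and their matrices *)

Section Operators.
Context {R : realType}.
Implicit Types E F G : completeNormedModType R[i].

Lemma lin0 E F (T : E -> F) : linear T -> T 0 = 0.
Proof. by move=> h; have := h (-1) 0 0; rewrite scaler0 addr0 scaleN1r addNr. Qed.

Lemma linZ E F (T : E -> F) c x : linear T -> T (c *: x) = c *: T x.
Proof. by move=> h; rewrite -[c *: x]addr0 h lin0 // addr0. Qed.

Lemma linD E F (T : E -> F) x y : linear T -> T (x + y) = T x + T y.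
Proof. by move=> h; rewrite -{1}[x]scale1r h scale1r. Qed.

Lemma linN E F (T : E -> F) x : linear T -> T (- x) = - T x.
Proof. by move=> h; rewrite -scaleN1r linZ // scaleN1r. Qed.

Lemma linB E F (T : E -> F) x y : linear T -> T (x - y) = T x - T y.
Proof. by move=> h; rewrite linD // linN. Qed.

Lemma lin_sum E F (T : E -> F) (I : Type) (r : seq I) (P : pred I) (g : I -> E) :
  linear T -> T (\sum_(i <- r | P i) g i) = \sum_(i <- r | P i) T (g i).
Proof.
by move=> h; apply: (big_morph T) => [x y|]; [exact: linD|exact: lin0].
Qed.

Definition bounded_linear E F (T : E -> F) : Prop :=
  linear T /\ exists2 C : R, 0 <= C & forall x, rnorm (T x) <= C * rnorm x.

Lemma bounded_operatorP E (T : E -> E) : bounded_operator T <-> bounded_linear T.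
Proof.
split=> -[lT].
  move=> cT; split=> //.
  have /cvgrPdist_lt/(_ 1 ltr01) : T x @[x --> 0] --> T 0 by apply: cT.
  move=> /nbhs_ballP[z /= /complex_gt0[-> z0] zB].
  set d := complex.Re z in z0 zB.
  exists (2 / d) => [|x]; first by rewrite divr_ge0 ?ltW.
  have [->|x0] := eqVneq x 0; first by rewrite lin0 // !rnorm0 mulr0.
  have rx : 0 < rnorm x by rewrite rnorm_gt0.
  set t := d / 2 / rnorm x.
  have t0 : 0 < t by rewrite !divr_gt0.
  have /zB : ball 0 d%:C (t%:C *: x).
    rewrite -ball_normE /ball_ /= sub0r normrN rnormE ltcR rnormZ cabsR gtr0_norm //.
    by rewrite /t mulfVK ?gt_eqF //; lra.
  rewrite lin0 // sub0r normrN rnormE ltcR linZ // rnormZ cabsR gtr0_norm //.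
  rewrite mulrC -ltr_pdivlMr // => /ltW /le_trans; apply.
  rewrite (_ : 1 / t = 2 / d * rnorm x) // /t.
  by field; rewrite !gt_eqF.
move=> [C C0 hC]; split=> // x; apply/cvgrPdist_lt => z /complex_gt0[-> z0].
have C1 : 0 < C + 1 by lra.
apply/nbhs_ballP; exists ((complex.Re z / (C + 1))%:C).
  by rewrite /= ltcR divr_gt0.
move=> y; rewrite -ball_normE /ball_ /= !rnormE !ltcR ltr_pdivlMr // => h.
rewrite -linB //; apply: (le_lt_trans (hC _)); apply: le_lt_trans h.
by rewrite mulrC ler_wpM2l ?rnorm_ge0 //; lra.
Qed.

Lemma bounded_linear_sub E F (S T : E -> F) :
  bounded_linear S -> bounded_linear T -> bounded_linear (S - T).
Proof.
move=> [lS [C C0 hC]] [lT [D D0 hD]]; split=> [c x y|].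
  by rewrite !fctE lS lT scalerBr opprD addrACA.
exists (C + D) => [|x]; first by rewrite addr_ge0.
by rewrite !fctE mulrDl; apply: (le_trans (rnormB _ _)); apply: lerD.
Qed.

Section OpnormOn.
Context {E : completeNormedModType R[i]}.
Variable A : set E.
Hypothesis AZ : forall (t : R) x, A x -> A (t%:C *: x).

(** The constant [C] ensures that the supremum is over a bounded set. Homogeneity is asked for real
    scalars, so that the lemma serves both [E] and its real span. *)
Lemma opnorm_on_ge (T : E -> E) (C : R) :
  (forall (t : R) x, A x -> T (t%:C *: x) = t%:C *: T x) -> 0 <= C ->
  (forall x, A x -> rnorm (T x) <= C * rnorm x) ->
  forall x, A x -> rnorm (T x) <= opnorm_on A T * rnorm x.
Proof.
move=> TZ C0 hC.
have ub x : A x -> rnorm x <= 1 -> rnorm (T x) <= opnorm_on A T.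
  move=> Ax x1; apply: ub_le_sup; last by exists x.
  exists C => _ [y [Ay y1] <-]; apply: (le_trans (hC _ Ay)).
  by rewrite ler_piMr.
move=> x Ax; have [x0|x0] := eqVneq (rnorm x) 0.
  by rewrite x0 mulr0 -(mulr0 C) -x0; exact: hC.
have rx : 0 < rnorm x by rewrite lt0r x0 rnorm_ge0.
rewrite -ler_pdivrMr //.
have ri : `|(rnorm x)^-1| = (rnorm x)^-1 by rewrite ger0_norm // invr_ge0 rnorm_ge0.
have := ub _ (AZ (rnorm x)^-1 Ax); rewrite rnormZ cabsR ri mulVf // lexx => /(_ isT).
by rewrite TZ // rnormZ cabsR ri mulrC.
Qed.

Lemma opnorm_on_le (T : E -> E) (C : R) : A 0 ->
  (forall x, A x -> rnorm x <= 1 -> rnorm (T x) <= C) -> opnorm_on A T <= C.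
Proof.
move=> A0 hC; apply: ge_sup.
  by exists (rnorm (T 0)), 0 => //; split=> //=; rewrite rnorm0.
by move=> _ [x [Ax x1] <-]; exact: hC.
Qed.

End OpnormOn.

Lemma opnorm_ge E (T : E -> E) x : bounded_linear T ->
  rnorm (T x) <= opnorm T * rnorm x.
Proof.
move=> [lT [C C0 hC]]; apply: (@opnorm_on_ge _ setT _ _ C) => //.
by move=> t y _; rewrite linZ.
Qed.

Lemma opnorm_le E (T : E -> E) (C : R) : 0 <= C ->
  (forall x, rnorm (T x) <= C * rnorm x) -> opnorm T <= C.
Proof.
move=> C0 hC; apply: opnorm_on_le => // x _ x1; apply: (le_trans (hC x)).
by rewrite ler_piMr.
Qed.

Section Matrix.
Context {E F : completeNormedModType R[i]}.
Variables (e : nat -> E) (f : nat -> F).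
Hypotheses (He : sym_basis e) (Hf : sym_basis f).

Lemma entry_le (T : E -> F) (C : R) m l :
  (forall x, rnorm (T x) <= C * rnorm x) -> cabs (nc f m (T (nb e l))) <= C.
Proof.
move=> hC; apply: (le_trans (nc_le Hf _ _)); apply: (le_trans (hC _)).
by rewrite nb_norm // mulr1.
Qed.

Lemma entry_expand (T : E -> F) x m (eps : R) : bounded_linear T -> 0 < eps ->
  exists N, forall k, (N <= k)%N ->
  cabs (\sum_(0 <= l < k) nc e l x * nc f m (T (nb e l)) - nc f m (T x)) < eps.
Proof.
move=> [lT [C C0 hC]] e0.
have C1 : 0 < C + 1 by lra.
have [N hN] := nc_expand He x (divr_gt0 e0 C1).
exists N => k /hN; rewrite ltr_pdivlMr //; apply: le_lt_trans.
set S := \sum_(0 <= i < k) _ *: _.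
have -> : \sum_(0 <= l < k) nc e l x * nc f m (T (nb e l)) = nc f m (T S).
  rewrite /S lin_sum // nc_sum //; apply: eq_bigr => i _.
  by rewrite linZ // ncZ.
rewrite -(ncB Hf) -(linB _ _ lT); apply: (le_trans (nc_le Hf _ _)).
by apply: (le_trans (hC _)); rewrite mulrC ler_wpM2l ?rnorm_ge0 //; lra.
Qed.

End Matrix.
End Operators.

Lemma card_le_bounded (A : set nat) N :
  A #<= `I_N -> exists L, forall n, A n -> (n < L)%N.
Proof.
move=> /card_le_finite/(_ (finite_II N))/finite_seqP[s ->].
exists (\max_(i <- s) i).+1 => n /= ns; rewrite ltnS.
exact: (@leq_bigmax_seq _ s xpredT id n ns isT).
Qed.

(** * Band operators *)

Section Balls.
Context {R : realType}.
Variable d : nat -> nat -> R.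
Hypothesis dM : metric_on_nat d.
Hypothesis dU : uniformly_locally_finite d.

Lemma dist_sym x y : d x y = d y x. Proof. by case: dM. Qed.
Lemma dist_tri x y z : d x z <= d x y + d y z. Proof. by case: dM. Qed.
Lemma dist_refl x : d x x = 0. Proof. by case: dM => _ h _ _; apply/h. Qed.
Lemma dist_ge0 x y : 0 <= d x y. Proof. by case: dM. Qed.

Lemma ball_size (r : R) : exists N, forall x (s : seq nat),
  uniq s -> (forall y, y \in s -> d x y <= r) -> (size s <= N)%N.
Proof.
(* Uniform local finiteness speaks of positive radii, hence the maximum with 1. *)
have r1 : 0 < Num.max r 1 by rewrite lt_max ltr01 orbT.
have [N hN] := dU r1; exists N => x s us hs.
have /pcard_leP[g] := hN x.
rewrite -(size_map g); apply: (@leq_trans (size (iota 0 N))); last by rewrite size_iota.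
apply: uniq_leq_size.
  rewrite map_inj_in_uniq // => y z ys zs; apply: (@inj _ _ _ g); rewrite inE /=;
    by rewrite le_max hs.
move=> _ /mapP[y ys ->]; rewrite mem_iota /=.
by apply: (@funS _ _ _ _ g); rewrite /= le_max hs.
Qed.

Lemma ball_bounded (r : R) x : exists L, forall y, d x y <= r -> (y < L)%N.
Proof.
have r1 : 0 < Num.max r 1 by rewrite lt_max ltr01 orbT.
have [N hN] := dU r1; have [L hL] := card_le_bounded (hN x).
by exists L => y h; apply: hL; rewrite /= le_max h.
Qed.

(** Greedy colouring: each point takes the first of [N.+1] colours absent from the earlier points in
    its ball, of which there are at most [N]. *)
Lemma ball_coloring (r : R) : exists (K : nat) (chi : nat -> nat),
  (forall n, (chi n < K)%N) /\
  forall m n, d m n <= r -> chi m = chi n -> m = n.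
Proof.
have [N hN] := ball_size r.
pose near (s : seq nat) n := [seq nth 0%N s m | m <- iota 0 n & d n m <= r].
pose fresh s n := find (fun c => c \notin near s n) (iota 0 N.+1).
have freshP s n : (fresh s n < N.+1)%N /\ fresh s n \notin near s n.
  have hs : has (fun c => c \notin near s n) (iota 0 N.+1).
    apply/negPn/negP; rewrite -all_predC => /allP h.
    have /(@uniq_leq_size _ _ _ (iota_uniq 0 N.+1)) : {subset iota 0 N.+1 <= near s n}.
      by move=> c /h /=; rewrite negbK.
    rewrite size_iota size_map ltnNge; apply/negP/negPn.
    apply: (hN n); first by rewrite filter_uniq // iota_uniq.
    by move=> y; rewrite mem_filter => /andP[].
  split; first by have := hs; rewrite has_find size_iota.
  by have := nth_find 0%N hs; rewrite nth_iota //; have := hs; rewrite has_find size_iota.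
pose fix col n := if n is m.+1 then rcons (col m) (fresh (col m) m) else [::].
have scol n : size (col n) = n by elim: n => //= n IH; rewrite size_rcons IH.
have ncol m n : (m < n)%N -> nth 0%N (col n) m = fresh (col m) m.
  elim: n => // n IH; rewrite ltnS leq_eqVlt => /orP[/eqP ->|mn].
    by rewrite /= nth_rcons scol ltnn eqxx.
  by rewrite /= nth_rcons scol mn IH.
exists N.+1, (fun n => fresh (col n) n); split=> [n|]; first by case: (freshP (col n) n).
have lt m n : (m < n)%N -> d n m <= r -> fresh (col m) m != fresh (col n) n.
  move=> mn dmn; apply/eqP => h; have [_ /negP] := freshP (col n) n; apply.
  rewrite -h; apply/mapP; exists m; last by rewrite ncol.
  by rewrite mem_filter dmn mem_iota.
move=> m n dmn h; case: (ltngtP m n) => // mn.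
  by have := lt _ _ mn; rewrite dist_sym h eqxx => /(_ dmn).
by have := lt _ _ mn dmn; rewrite h eqxx.
Qed.

End Balls.

(** Matched points are swapped; the default value [x] of [xget] fixes all others, so [pi] is its own
    inverse. *)
Lemma involution_of_matching (Q : nat -> nat -> Prop) :
  (forall x y, Q x y -> Q y x) -> (forall x y z, Q x y -> Q x z -> y = z) ->
  exists2 pi : nat -> nat, bijective pi & forall x y, Q x y -> pi x = y.
Proof.
move=> Qs Qf; pose pi x := xget x [set y | Q x y].
have piQ x y : Q x y -> pi x = y.
  by move=> h; apply: (Qf x) => //; apply: (@xgetPex _ x [set y | Q x y]); exists y.
exists pi => //; exists pi => x;
  (have [[y h]|h] := pselect (exists y, Q x y);
    [by rewrite (piQ _ _ h) (piQ y x) //; exact: Qs|]);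
  have px : pi x = x by (apply: xgetPN => y hy; apply: h; exists y).
  by rewrite !px.
by rewrite !px.
Qed.

Section Band.
Context {R : realType} {E : completeNormedModType R[i]}.
Variable e : nat -> E.
Hypothesis He : sym_basis e.

Lemma perm_operator pi : bijective pi -> exists lam : R, exists T : E -> E,
  [/\ 0 < lam, linear T, forall x, rnorm (T x) <= lam * rnorm x
    & forall n x, nc e (pi n) (T x) = nc e n x].
Proof.
move=> piB; have [ip piK ipK] := piB; have [lam lam0 h] := nc_perm He piB.
have /choice[T hT] : forall x, exists y,
    (forall n, nc e (pi n) y = nc e n x) /\ rnorm y <= lam * rnorm x.
  by move=> x; have [y h1 h2] := h x; exists y.
exists lam, T; split=> // [c x y|x|n x]; last by have [-> _] := hT x.
  apply: (nc_ext He) => n; rewrite -[n]ipK nc_lin //.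
  by have [-> _] := hT x; have [-> _] := hT y; have [-> _] := hT (c *: x + y); rewrite nc_lin.
by have [_] := hT x.
Qed.

Lemma diag_operator (al : nat -> R[i]) (K : R) : (forall n, cabs (al n) <= K) ->
  exists T : E -> E, [/\ linear T, forall x, rnorm (T x) <= K * rnorm x
    & forall n x, nc e n (T x) = al n * nc e n x].
Proof.
move=> h; have K0 : 0 <= K by apply: le_trans (h 0%N); rewrite cabs_ge0.
have hx x n : cabs (al n * nc e n x) <= cabs (nc e n (K%:C *: x)).
  by rewrite ncZ // !cabsM cabsR ger0_norm // ler_wpM2r ?cabs_ge0.
have /choice[T hT] : forall x, exists y, forall n, nc e n y = al n * nc e n x.
  by move=> x; apply: (nc_dom He (hx x)).
exists T; split=> // [c x y|x].
  by apply: (nc_ext He) => n; rewrite nc_lin // !hT nc_lin // mulrDr mulrCA.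
rewrite -[K]ger0_norm // -cabsR -rnormZ; apply: (nc_mono He) => n.
by rewrite hT; exact: hx.
Qed.

Variable d : nat -> nat -> R.
Hypothesis dM : metric_on_nat d.
Hypothesis dU : uniformly_locally_finite d.

(* A vertex colouring separating points at distance at most [2 * s] splits the
   band of width [s] into finitely many matchings, each of which extends to an
   involution of [nat]. *)
Lemma band_matrix_operator (s : R) : exists2 C : R, 0 < C &
  forall (c : nat -> nat -> R[i]) (K : R),
  (forall m l, cabs (c m l) <= K) -> (forall m l, s < d l m -> c m l = 0) ->
  exists T : E -> E, [/\ linear T, forall x, rnorm (T x) <= C * K * rnorm x
    & forall m l, nc e m (T (nb e l)) = c m l].
Proof.
have [k [chi [chik chiI]]] := ball_coloring dM dU (s + s).
have sepa x y z : d x y <= s -> d x z <= s -> chi y = chi z -> y = z.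
  move=> h1 h2; apply: chiI; apply: le_trans (dist_tri dM y x z) _.
  by rewrite (dist_sym dM y x) lerD.
have /choice[pi hpi] : forall p : 'I_k * 'I_k, exists pi : nat -> nat,
    bijective pi /\ forall m l, chi m = p.1 -> chi l = p.2 -> d l m <= s -> pi l = m.
  (* Both orders of the two colours are allowed to make the relation symmetric. Partners are unique
     because points within [s] of a common point have distinct colours. *)
  move=> p; pose Q x y := ((chi x = p.1 /\ chi y = p.2) \/ (chi x = p.2 /\ chi y = p.1))
                           /\ d x y <= s.
  have [x y [h hs]|x y z [h hs] [h' hs']|pi pB hp] := @involution_of_matching Q.
  - by split; [tauto|rewrite dist_sym].
  - by apply: (@sepa x) => //; case: h => -[h1 h2]; case: h' => -[h3 h4]; congruence.
  by exists pi; split=> // m l hm hl hs; apply: hp; split=> //; right.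
have /choice[lam hlam] : forall p, exists lam : R, exists T : E -> E,
  [/\ 0 < lam, linear T, forall x, rnorm (T x) <= lam * rnorm x
    & forall n x, nc e (pi p n) (T x) = nc e n x].
  by move=> p; apply: perm_operator; case: (hpi p).
have /choice[T hT] := hlam.
have C0 : 0 <= \sum_p lam p by apply: sumr_ge0 => p _; apply: ltW; case: (hT p).
exists (\sum_p lam p + 1); first by lra.
move=> c K cK cs.
have K0 : 0 <= K by apply: le_trans (cK 0%N 0%N); rewrite cabs_ge0.
(* The block with row colour [p.1] and column colour [p.2] is a diagonal operator followed by the
   permutation [pi p]; the test discards the columns that [pi p] sends outside this block. *)
pose al (p : 'I_k * 'I_k) l := if [&& chi l == p.2, chi (pi p l) == p.1 & d l (pi p l) <= s]
               then c (pi p l) l else 0.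
have /choice[D hD] : forall p, exists D : E -> E,
  [/\ linear D, forall x, rnorm (D x) <= K * rnorm x
    & forall n x, nc e n (D x) = al p n * nc e n x].
  by move=> p; apply: diag_operator => n; rewrite /al; case: ifP => // _; rewrite cabs0.
exists (fun x => \sum_p T p (D p x)); split.
- move=> a x y; rewrite scaler_sumr -big_split /=; apply: eq_bigr => p _.
  by have [_ lT _ _] := hT p; have [lD _ _] := hD p; rewrite lD lT.
- move=> x; apply: (le_trans (rnorm_sum _ _ _)).
  apply: (@le_trans _ _ (\sum_p lam p * K * rnorm x)).
    apply: ler_sum => p _; have [l0 _ hTb _] := hT p; have [_ hDb _] := hD p.
    by apply: (le_trans (hTb _)); rewrite -mulrA ler_pM2l.
  rewrite -!mulr_suml ler_wpM2r ?rnorm_ge0 // ler_wpM2r // lerDl ler01 //.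
move=> m l; rewrite nc_sum //.
have term p : nc e m (T p (D p (nb e l))) = al p l * (m == pi p l)%:R.
  have [_ _ _ h2] := hT p; have [_ _ h1] := hD p.
  have [[ip piK ipK] _] := hpi p.
  rewrite -{1}[m]ipK h2 h1 nc_nb // (_ : (m == pi p l) = (ip m == l)).
    by case: eqP => [->|_] //; rewrite !mulr0.
  by rewrite -[RHS](inj_eq (can_inj piK)) ipK.
rewrite (eq_bigr _ (fun p _ => term p)).
have [dml|dml] := leP (d l m) s; last first.
  rewrite cs // big1 // => p _; rewrite /al.
  have [<-|_] := eqVneq m (pi p l); last by rewrite mulr0.
  by rewrite leNgt dml !andbF mul0r.
(* Each position of the band lies in exactly one block, that of the colours of its row and
   column. *)
pose p0 := (Ordinal (chik m), Ordinal (chik l)).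
have pl : pi p0 l = m by have [_ h] := hpi p0; apply: h.
rewrite (bigD1 p0) //= pl eqxx mulr1 {1}/al /= pl !eqxx dml /=.
rewrite big1 ?addr0 // => -[i j] ij; case: eqP => [mp|_]; last by rewrite mulr0.
rewrite /al /= -mp; case: ifP => [/and3P[/eqP h1 /eqP h2 _]|_]; last by rewrite mul0r.
by case/eqP: ij; congr (_, _); apply: val_inj.
Qed.

End Band.

(** * Increasing index sequences and almost diagonal subsequences *)

Lemma increasing_choice (P : nat -> nat -> nat -> Prop) :
  (forall N k, exists2 n, (N < n)%N & P N k n) ->
  exists phi : nat -> nat, forall k, (phi k < phi k.+1)%N /\ P (phi k) k (phi k.+1).
Proof.
move=> h; have /choice[g hg] : forall Nk : nat * nat, exists n, (Nk.1 < n)%N /\ P Nk.1 Nk.2 n.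
  by move=> [N k]; have [n h1 h2] := h N k; exists n.
pose fix phi k := if k is j.+1 then g (phi j, j) else 0%N.
by exists phi => k; exact: (hg (phi k, k)).
Qed.

Lemma increasing_homo (phi : nat -> nat) : (forall k, (phi k < phi k.+1)%N) ->
  {mono phi : i j / (i < j)%N}.
Proof.
move=> h; apply: leqW_mono; apply: leq_mono.
by apply: homo_ltn => //; exact: ltn_trans.
Qed.

Lemma leq_mono_ltn (phi : nat -> nat) : {mono phi : i j / (i < j)%N} ->
  {mono phi : i j / (i <= j)%N}.
Proof. by move=> h i j; rewrite leqNgt h -leqNgt. Qed.

Lemma increasing_ge (phi : nat -> nat) : {mono phi : i j / (i < j)%N} ->
  forall k, (k <= phi k)%N.
Proof.
move=> h; elim=> // k IH; apply: leq_ltn_trans IH _.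
by rewrite h.
Qed.

Section Subsequence.
Context {R : realType}.

Lemma sum_geometric (K : nat) : \sum_(0 <= k < K) (2 ^- k.+1 : R) = 1 - 2 ^- K.
Proof.
elim: K => [|K IH]; first by rewrite big_geq // expr0 invr1 subrr.
rewrite big_nat_recr //= IH exprS.
have : (2 : R) ^+ K != 0 by rewrite expf_neq0 ?pnatr_eq0.
by move=> h; field.
Qed.

Lemma eventually_small_upto (X : nat -> nat -> R) (N : nat) (eps : R) :
  (forall i, exists J, forall j, (J <= j)%N -> X i j < eps) ->
  exists J, forall i j, (i <= N)%N -> (J <= j)%N -> X i j < eps.
Proof.
move=> /choice[J hJ]; exists (\max_(i < N.+1) J i) => i j iN h; apply: hJ.
apply: leq_trans h; rewrite -ltnS in iN.
exact: (@leq_bigmax_cond _ xpredT (fun i : 'I_N.+1 => J i) (Ordinal iN) isT).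
Qed.

(** Each index is chosen so late that its interaction with every smaller or equal index up to the
    previous choice, in both orders, is below a term of a geometric series. An off-diagonal pair is
    then controlled by its later member. *)
Lemma almost_diagonal_subsequence (X : nat -> nat -> R) (eps : R) : 0 < eps ->
  (forall i j, 0 <= X i j) ->
  (forall (del : R) i, 0 < del -> exists J, forall j, (J <= j)%N -> X i j < del) ->
  (forall (del : R) j, 0 < del -> exists I, forall i, (I <= i)%N -> X i j < del) ->
  exists2 phi : nat -> nat, {mono phi : i j / (i < j)%N} &
    forall k K, \sum_(0 <= l < K | l != k) X (phi k) (phi l) <= eps.
Proof.
move=> e0 X0 X1 X2.
have d0 k : 0 < eps * 2 ^- k.+2 by rewrite mulr_gt0 // invr_gt0 exprn_gt0.
have [phi hphi] : exists phi : nat -> nat, forall k, (phi k < phi k.+1)%N /\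
    forall i, (i <= phi k)%N ->
      X i (phi k.+1) < eps * 2 ^- k.+2 /\ X (phi k.+1) i < eps * 2 ^- k.+2.
  apply: (@increasing_choice (fun N k n => forall i, (i <= N)%N ->
      X i n < eps * 2 ^- k.+2 /\ X n i < eps * 2 ^- k.+2)) => N k.
  have [J hJ] := @eventually_small_upto X N _ (fun i => X1 _ i (d0 k)).
  have [I hI] := @eventually_small_upto (fun i j => X j i) N _ (fun i => X2 _ i (d0 k)).
  exists (maxn N.+1 (maxn J I)); first by rewrite leq_max leqnn.
  move=> i iN; split; [apply: hJ => //|apply: hI => //].
    by rewrite !leq_max leqnn orbT.
  by rewrite !leq_max leqnn !orbT.
have mphi := increasing_homo (fun k => (hphi k).1).
have lphi i j : (i <= j)%N -> (phi i <= phi j)%N by rewrite (leq_mono_ltn mphi).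
exists phi => // k K.
have Xle l : l != k -> X (phi k) (phi l) <= eps * 2 ^- l.+1.
  case: (ltngtP l k) => // lk _.
    case: k lk => // k; rewrite ltnS => lk; have [_ /(_ _ (lphi _ _ lk))[_ h]] := hphi k.
    apply: (le_trans (ltW h)); rewrite ler_pM2l // lef_pV2 ?posrE ?exprn_gt0 //.
    by rewrite ler_eXn2l ?ltr1n // !ltnS (leq_trans lk).
  case: l lk => // l; rewrite ltnS => kl; have [_ /(_ _ (lphi _ _ kl))[h _]] := hphi l.
  exact: ltW.
apply: (@le_trans _ _ (\sum_(0 <= l < K) eps * 2 ^- l.+1)).
  rewrite big_mkcond /=; apply: ler_sum => l _; case: ifP => [/Xle|] // _.
  by rewrite mulr_ge0 ?invr_ge0 ?exprn_ge0 // ltW.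
by rewrite -mulr_sumr sum_geometric ler_piMr ?(ltW e0) //.
Qed.

End Subsequence.

(** * Kernels obtained from property A *)

Section Kernel.
Context {R : realType}.
Implicit Types d del : nat -> nat -> R.

(** These entrywise conditions are what Schur multiplication for the regular norm requires, and in
    this form the property pulls back along a coarse embedding by mere composition. *)
Definition approx_kernel d : Prop :=
  forall r eps : R, 0 < r -> 0 < eps ->
  exists (k : nat -> nat -> R) (D : R),
  [/\ forall m l, 0 <= k m l <= 1,
      forall m l, D < d m l -> k m l = 0
    & forall m l, d m l < r -> 1 - k m l <= eps].

Lemma nneseries_finite (g : nat -> R) L : (forall n, (L <= n)%N -> g n = 0) ->
  (\sum_(0 <= n <oo) (g n)%:E)%E = (\sum_(0 <= n < L) g n)%:E.
Proof.
move=> h; apply: lim_near_cst => //; exists L => // n /= Ln.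
rewrite (big_cat_nat (leq0n L) Ln) /= [X in (_ + X)%E]big_nat_cond.
rewrite [X in (_ + X)%E]big1 ?adde0 ?sumEFin //.
by move=> i /andP[/andP[Li _] _]; rewrite h.
Qed.

(* [k m l = \sum_n phi n m * phi n l], so that
   [\sum_n (phi n m - phi n l) ^+ 2 = 2 * (1 - k m l)]. *)
Lemma property_A_kernel d : property_A d -> approx_kernel d.
Proof.
move=> A r eps r0 eps0.
(* The variation is bounded by a square; capping at 1 keeps that square below [eps]. *)
have e0 : 0 < Num.min eps 1 by rewrite lt_min eps0 ltr01.
have [phi [[phi01 [N hN] [D hD] phi1] hv]] := A _ _ r0 e0.
have /choice[L hL] : forall m, exists L, forall n, (L <= n)%N -> phi n m = 0.
  move=> m; have [L hL] := card_le_bounded (hN m); exists L => n Ln.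
  by apply/eqP/negPn/negP => /hL; rewrite ltnNge Ln.
pose M m l := maxn (L m) (L l).
have Mm m l n : (M m l <= n)%N -> phi n m = 0 by rewrite geq_max => /andP[/hL].
have Ml m l n : (M m l <= n)%N -> phi n l = 0 by rewrite geq_max => /andP[_ /hL].
pose k m l := \sum_(0 <= n < M m l) phi n m * phi n l.
have sq1 m l : \sum_(0 <= n < M m l) phi n m ^+ 2 = 1.
  have := phi1 m; rewrite (@nneseries_finite _ (M m l)); first by case.
  by move=> n h; rewrite (Mm m l) // expr0n.
have sq2 m l : \sum_(0 <= n < M m l) phi n l ^+ 2 = 1.
  have := phi1 l; rewrite (@nneseries_finite _ (M m l)); first by case.
  by move=> n h; rewrite (Ml m l) // expr0n.
have sqk m l : \sum_(0 <= n < M m l) (phi n m - phi n l) ^+ 2 = 2 - 2 * k m l.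
  rewrite (eq_bigr (fun n => phi n m ^+ 2 + phi n l ^+ 2 + -2 * (phi n m * phi n l))).
    by rewrite !big_split /= sq1 sq2 -mulr_sumr -/(k m l); lra.
  by move=> n _; ring.
have k0 m l : 0 <= k m l.
  apply: sumr_ge0 => n _.
  by have /andP[h1 _] := phi01 n m; have /andP[h2 _] := phi01 n l; rewrite mulr_ge0.
exists k, D; split=> [m l|m l Dml|m l mlr].
- rewrite k0 /=; have : 0 <= 2 - 2 * k m l; last by lra.
  by rewrite -sqk; apply: sumr_ge0 => n _; rewrite sqr_ge0.
- apply: big1 => n _; apply/eqP; rewrite mulf_eq0 -[_ || _]negbK negb_or.
  by apply/negP => /andP[h1 h2]; have := hD n m l h1 h2; rewrite leNgt Dml.
- have := hv _ _ mlr; rewrite (@nneseries_finite _ (M m l)); last first.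
    by move=> n h; rewrite (Ml m l) // (Mm m l) // subrr normr0 expr0n.
  rewrite lte_fin; under eq_bigr do rewrite real_normK ?num_real //.
  rewrite sqk => h.
  have m1 : Num.min eps 1 <= 1 by rewrite ge_min lexx orbT.
  have m2 : Num.min eps 1 <= eps by rewrite ge_min lexx.
  have : Num.min eps 1 ^+ 2 <= Num.min eps 1 by rewrite expr2 ler_piMr // ltW.
  by lra.
Qed.

Lemma approx_kernel_pullback d del (h : nat -> nat) :
  coarse_embedding d del h -> approx_kernel del -> approx_kernel d.
Proof.
move=> [hc he] A r eps r0 eps0.
have [s s0 hs] := hc r r0.
have [k [D [k01 kD kr]]] := A s eps s0 eps0.
have D1 : 0 < Num.max D 1 by rewrite lt_max ltr01 orbT.
have [t _ ht] := he _ D1.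
exists (fun m l => k (h m) (h l)), t; split=> // m l.
  by move=> /ht; rewrite gt_max => /andP[/kD].
by move=> /hs; exact: kr.
Qed.

End Kernel.

(** * Entries of operators in the uniform Roe algebra, and partial translations *)

Section Roe.
Context {R : realType} {E : completeNormedModType R[i]}.
Variables (e : nat -> E) (d : nat -> nat -> R).
Hypotheses (He : sym_basis e) (dM : metric_on_nat d) (dU : uniformly_locally_finite d).

Lemma band_entry (a : E -> E) : linear a ->
  forall m l, (biorthogonal e m (a (e l)) == 0) = (nc e m (a (nb e l)) == 0).
Proof.
move=> la m l; rewrite (biorthogonal_eq0 He) (nbE He l) (linZ _ _ la) (ncZ He).
rewrite mulf_eq0 -(rmorph0 (real_complex R)) (inj_eq (@complexI R)).
by rewrite (gt_eqF (rnorm_basis_gt0 He l)).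
Qed.

Lemma band_operatorP (a : E -> E) (s : R) : bounded_linear a ->
  (forall m l, s < d l m -> nc e m (a (nb e l)) = 0) -> band_operator d e a.
Proof.
move=> ba ha; split; first by apply/bounded_operatorP.
exists (Num.max s 1); first by rewrite lt_max ltr01 orbT.
move=> n m; rewrite gt_max => /andP[h _]; apply/eqP.
by rewrite band_entry ?ha //; case: ba.
Qed.

Lemma band_operator_entries (a : E -> E) : band_operator d e a ->
  bounded_linear a /\ exists2 s : R, 0 < s & forall m l, s < d l m -> nc e m (a (nb e l)) = 0.
Proof.
move=> [/bounded_operatorP ba [s s0 hs]]; split=> //; exists s => // m l h.
by apply/eqP; rewrite -band_entry ?hs //; case: ba.
Qed.

Lemma band_uniform_roe (a : E -> E) : band_operator d e a -> uniform_roe d e a.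
Proof.
move=> ba; split=> [|eps e0]; first by case: ba.
exists a => //; apply: le_lt_trans e0.
by apply: opnorm_le => // x; rewrite !fctE subrr rnorm0 mul0r.
Qed.

Lemma uniform_roe_bounded (a : E -> E) : uniform_roe d e a -> bounded_linear a.
Proof. by move=> [/bounded_operatorP]. Qed.

(** Off its band, an approximating band operator has entry zero, and the norm of the difference
    bounds the entry that is left. *)
Lemma uniform_roe_entries (a : E -> E) (eps : R) : uniform_roe d e a -> 0 < eps ->
  exists s : R, forall m l, s < d l m -> cabs (nc e m (a (nb e l))) < eps.
Proof.
move=> ra e0; have [_ /(_ _ e0)[b /band_operator_entries[bb [s _ hs]] hb]] := ra.
have bab := bounded_linear_sub (uniform_roe_bounded ra) bb.
exists s => m l /hs b0; apply: le_lt_trans hb.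
have := entry_le He He m l (fun x => opnorm_ge x bab).
by rewrite !fctE ncB // b0 subr0.
Qed.

(** The convergence clause is what later expands the entries of [U \o a \o V] into a series of
    entries of images of matrix units. *)
Lemma partial_translation (nu nu' : nat -> nat) (r : R) :
  {mono nu : i j / (i < j)%N} -> {mono nu' : i j / (i < j)%N} ->
  (forall k, d (nu k) (nu' k) <= r) ->
  exists a : E -> E, [/\ band_operator d e a,
    forall x, tends (fun K => \sum_(0 <= k < K) nc e (nu' k) x *: nb e (nu k)) (a x)
    & forall k, a (nb e (nu' k)) = nb e (nu k)].
Proof.
move=> hnu hnu' hr.
have nuI : injective nu by apply: incn_inj; exact: leq_mono_ltn.
have nuI' : injective nu' by apply: incn_inj; exact: leq_mono_ltn.
have ge' := increasing_ge hnu'.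
(* Since [k <= nu' k], an index [k] with [l = nu' k] is at most [l], so the search is finite. *)
pose c m l : R[i] := ([exists k : 'I_l.+1, (m == nu k) && (l == nu' k)] : bool)%:R.
have cE m l K : (l < nu' K)%N -> c m l = \sum_(0 <= k < K) (m == nu k)%:R * (l == nu' k)%:R.
  move=> lK; rewrite /c; case: existsP => [[[k kl] /= /andP[/eqP hm /eqP hl]]|h].
    rewrite (bigD1_seq k) ?mem_index_iota ?iota_uniq //=; last first.
      by rewrite -hnu' -hl.
    rewrite hm hl !eqxx mulr1 big1 ?addr0 // => i ik.
    by rewrite (inj_eq nuI) eq_sym (negbTE ik) mul0r.
  rewrite big1 // => k _; case: eqP => [hm|_]; last by rewrite mul0r.
  case: eqP => [hl|_]; last by rewrite mulr0.
  have kl : (k < l.+1)%N by rewrite ltnS hl.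
  by case: h; exists (Ordinal kl); rewrite /= hm hl !eqxx.
have c1 m l : cabs (c m l) <= 1.
  by rewrite /c; case: [exists _, _]; rewrite ?cabs1 // cabs0.
have cr m l : r < d l m -> c m l = 0.
  move=> h; rewrite /c; case: existsP => // -[[k kl] /= /andP[/eqP hm /eqP hl]].
  by move: h; rewrite hm hl (dist_sym dM) ltNge hr.
have [C C0 hC] := band_matrix_operator He dM dU r.
have [a [la ba ha]] := hC c 1 c1 cr.
have bla : bounded_linear a by split=> //; exists (C * 1) => //; rewrite mulr1 ltW.
have band_a : band_operator d e a.
  by apply: (@band_operatorP _ r) => // m l h; rewrite ha cr.
have nbc m l : nc e m (a (nb e l)) = c m l by exact: ha.
exists a; split=> // [x eps e0|k]; last first.
  apply: (nc_ext He) => m; rewrite nbc nc_nb // (cE _ _ k.+1) ?hnu' //.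
  rewrite big_nat_recr //= eqxx mulr1 big_nat_cond big1 ?add0r // => i /andP[/andP[_ ik] _].
  by rewrite (inj_eq nuI') (gtn_eqF ik) mulr0.
have [N hN] := nc_expand He x (divr_gt0 e0 C0).
exists N => K NK; have := hN _ (leq_trans NK (ge' K)).
set S := \sum_(0 <= i < nu' K) _.
(* As [nu'] increases, the first [K] matrix units are those with source below [nu' K]; their sum at
   [x] is [a] at a truncation of [x]. *)
have -> : \sum_(0 <= k < K) nc e (nu' k) x *: nb e (nu k) = a S.
  apply: (nc_ext He) => m; rewrite /S lin_sum // !nc_sum //.
  rewrite [RHS](eq_big_nat _ _ (F2 := fun i => \sum_(0 <= k < K)
    nc e i x * ((m == nu k)%:R * (i == nu' k)%:R))); last first.
    by move=> i /andP[_ iK]; rewrite linZ // ncZ // nbc (cE _ _ K) // mulr_sumr.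
  rewrite exchange_big_nat /=; apply: eq_big_nat => k /andP[_ kK].
  rewrite ncZ // nc_nb // (bigD1_seq (nu' k)) ?mem_index_iota ?iota_uniq ?hnu' //=.
  rewrite eqxx mulr1 big1 ?addr0 // => i ik.
  by rewrite (negbTE ik) !mulr0.
rewrite -linB // ltr_pdivlMr // => h; apply: le_lt_trans (ba _) _.
by rewrite mulr1 mulrC.
Qed.

End Roe.

(** * Images of matrix units under a spatial isomorphism *)

Section Implemented.
Context {R : realType}.

(** The algebra clauses are inclusions in one direction; the inverse isomorphism satisfies the same
    predicate with the two sides exchanged, so each later lemma can be applied both ways. *)
Definition spatial (E F : completeNormedModType R[i]) (e : nat -> E) (f : nat -> F)
    (d del : nat -> nat -> R) (U : E -> F) (V : F -> E) : Prop :=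
  [/\ bounded_linear U /\ bounded_linear V, cancel U V, cancel V U,
      forall a, uniform_roe d e a -> uniform_roe del f (U \o a \o V)
    & forall a, regular_roe d e a -> regular_roe del f (U \o a \o V)].

Context {E F : completeNormedModType R[i]}.
Variables (e : nat -> E) (f : nat -> F) (d del : nat -> nat -> R) (U : E -> F) (V : F -> E).
Hypotheses (He : sym_basis e) (Hf : sym_basis f).
Hypotheses (dM : metric_on_nat d) (dU : uniformly_locally_finite d).
Hypotheses (delM : metric_on_nat del) (delU : uniformly_locally_finite del).
Hypothesis HU : spatial e f d del U V.

Definition ent2 m n n' l : R[i] := nc f m (U (nb e n)) * nc e n' (V (nb f l)).

Let bU : bounded_linear U. Proof. by case: HU => -[]. Qed.

Lemma ent2_series (nu nu' : nat -> nat) (a : E -> E) :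
  (forall x, tends (fun K => \sum_(0 <= k < K) nc e (nu' k) x *: nb e (nu k)) (a x)) ->
  forall m l (eps : R), 0 < eps -> exists N, forall K, (N <= K)%N ->
  cabs (nc f m ((U \o a \o V) (nb f l)) - \sum_(0 <= k < K) ent2 m (nu k) (nu' k) l) < eps.
Proof.
move=> ha m l eps e0; have [lU [C C0 hC]] := bU.
have C1 : 0 < C + 1 by lra.
have [N hN] := ha (V (nb f l)) _ (divr_gt0 e0 C1).
exists N => K /hN; rewrite ltr_pdivlMr //; apply: le_lt_trans.
have -> : \sum_(0 <= k < K) ent2 m (nu k) (nu' k) l =
    nc f m (U (\sum_(0 <= k < K) nc e (nu' k) (V (nb f l)) *: nb e (nu k))).
  rewrite lin_sum // nc_sum //; apply: eq_bigr => k _.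
  by rewrite linZ // ncZ // mulrC.
rewrite -ncB // -(linB _ _ lU) -cabsN -ncN //; apply: (le_trans (nc_le Hf _ _)).
rewrite rnormN; apply: (le_trans (hC _)).
by rewrite rnormC mulrC ler_wpM2l ?rnorm_ge0 //; lra.
Qed.

Lemma rank1_bounded (G H : completeNormedModType R[i]) (g : nat -> G) (y : H) n :
  sym_basis g -> bounded_linear (fun x => nc g n x *: y).
Proof.
move=> Hg; split=> [c x z|]; first by rewrite nc_lin // scalerDl scalerA.
by exists (rnorm y) => [|x]; rewrite ?rnorm_ge0 // rnormZ mulrC ler_wpM2l ?rnorm_ge0 ?nc_le.
Qed.

(** For a single matrix unit the decay is that of one element of the Roe algebra. The bound is a
    natural number so that maxima over finitely many pairs can be taken. *)
Lemma ent2_offdiag n n' (eps : R) : 0 < eps ->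
  exists s : nat, forall m l, s%:R < del l m -> cabs (ent2 m n n' l) < eps.
Proof.
move=> e0; have [_ _ _ hU _] := HU.
have [|s hs] := uniform_roe_entries Hf (hU (fun x => nc e n' x *: nb e n) _) e0.
  apply/band_uniform_roe/(@band_operatorP _ _ _ _ He _ (d n' n)).
    exact: rank1_bounded.
  move=> m l; rewrite nc_nb // ncZ // nc_nb //.
  have [->|] := eqVneq n' l; last by rewrite mul0r.
  have [->|] := eqVneq m n; last by rewrite mulr0.
  by rewrite ltxx.
exists (Num.bound `|s|) => m l h; have := hs m l.
rewrite /= linZ ?ncZ //; last by case: bU.
rewrite mulrC; apply.
by apply: le_lt_trans h; exact: le_trans (ler_norm s) (ltW (archi_boundP (normr_ge0 s))).
Qed.

(* Otherwise a gliding hump yields infinitely many bad pairs whose matrix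
   units add up to a partial translation of width [r], while its image has
   large entries arbitrarily far from the diagonal. *)
Lemma spatial_entries_band (r eta : R) : 0 < eta ->
  exists s : R, forall m n n' l, d n n' <= r -> s < del l m ->
    cabs (ent2 m n n' l) < eta.
Proof.
move=> eta0; apply: contrapT => hcon.
have /choice[q hq] : forall j : nat, exists q : nat * nat * (nat * nat),
    [/\ d q.1.1 q.1.2 <= r, j%:R < del q.2.2 q.2.1
      & eta <= cabs (ent2 q.2.1 q.1.1 q.1.2 q.2.2)].
  move=> j; apply: contrapT => hj; apply: hcon; exists j%:R => m n n' l h1 h2.
  by rewrite ltNge; apply/negP => h3; apply: hj; exists ((n, n'), (m, l)).
pose n j := (q j).1.1; pose n' j := (q j).1.2.
pose m j := (q j).2.1; pose l j := (q j).2.2.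
have qd j : d (n j) (n' j) <= r by case: (hq j).
have qs j : j%:R < del (l j) (m j) by case: (hq j).
have qe j : eta <= cabs (ent2 (m j) (n j) (n' j) (l j)) by case: (hq j).
(* If [n j] or [n' j] is at most [N], then both lie below [L], since they are within [r] of each
   other. Only finitely many pairs are below [L], and [ent2_offdiag] excludes all of them for large
   [j]. *)
have ninf N : exists J, forall j, (J <= j)%N -> (N < n j)%N /\ (N < n' j)%N.
  have /choice[B hB] : forall x, exists L, forall y, d x y <= r -> (y < L)%N.
    by move=> x; exact: ball_bounded.
  pose L := maxn N.+1 (\max_(i < N.+1) B i).
  have LB x : (x <= N)%N -> (B x <= L)%N.
    move=> xN; rewrite -ltnS in xN; rewrite /L leq_max.
    by rewrite (@leq_bigmax_cond _ xpredT (fun i : 'I_N.+1 => B i) (Ordinal xN) isT) orbT.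
  have /choice[J hJ] : forall p : 'I_L * 'I_L, exists s : nat, forall m l,
      s%:R < del l m -> cabs (ent2 m p.1 p.2 l) < eta.
    by move=> p; exact: ent2_offdiag.
  exists (\max_p J p) => j Jj.
  have far : (n j < L)%N -> (n' j < L)%N -> False.
    move=> h1 h2; have := qe j; rewrite leNgt => /negP; apply.
    apply: (hJ (Ordinal h1, Ordinal h2)); apply: le_lt_trans (qs j).
    rewrite ler_nat; apply: leq_trans Jj.
    exact: (@leq_bigmax_cond _ xpredT J (Ordinal h1, Ordinal h2) isT).
  have NL x : (x <= N)%N -> (x < L)%N by move=> h; rewrite /L leq_max ltnS h.
  split; rewrite ltnNge; apply/negP => h; apply: far; try exact: NL.
    by apply: leq_trans (LB _ h); apply: hB.
  by apply: leq_trans (LB _ h); apply: hB; rewrite dist_sym.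
(* This penalty of size 1 marks pairs of indices along which [n] or [n'] fails to increase. The
   off-diagonal sums will be at most 1/2, so the subsequence avoids it and makes both sequences
   strictly increasing. *)
pose I i j : R := if [&& (i < j)%N & ((n j <= n i) || (n' j <= n' i))%N] then 1 else 0.
pose X i j := cabs (ent2 (m i) (n j) (n' j) (l i)) + I i j.
have I0 i j : 0 <= I i j by rewrite /I; case: ifP.
have e0 : 0 < Num.min eta 1 / 2 by rewrite divr_gt0 // lt_min eta0 ltr01.
have [lU [C C0 hC]] := bU.
have [|del0 i del0_gt0|del0 j del0_gt0|phi mphi hphi] := @almost_diagonal_subsequence _ X _ e0.
- by move=> i j; rewrite addr_ge0 ?cabs_ge0.
(* For fixed [i] the coordinates of [V (nb f (l i))] tend to zero; for fixed [j], treated next, a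
   single matrix unit is involved. *)
- have C1 : 0 < C + 1 by lra.
  have [N hN] := nc_tail He (V (nb f (l i))) (divr_gt0 del0_gt0 C1).
  have [J hJ] := ninf (maxn N (maxn (n i) (n' i))); exists J => j Jj.
  have [] := hJ j Jj; rewrite !gtn_max => /and3P[_ h1 _] /and3P[h2 _ h3].
  rewrite /X /I (leqNgt (n j)) (leqNgt (n' j)) h1 h3 andbF addr0 /ent2 cabsM.
  have := hN _ (ltnW h2); rewrite ltr_pdivlMr // mulrC; apply: le_lt_trans.
  rewrite ler_wpM2r ?cabs_ge0 //.
  by apply: le_trans (entry_le He Hf _ _ hC) _; lra.
- have [s hs] := ent2_offdiag (n j) (n' j) del0_gt0.
  exists (maxn s j) => i; rewrite geq_max => /andP[si ji].
  rewrite /X /I ltnNge ji /= addr0; apply: hs; apply: le_lt_trans (qs i).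
  by rewrite ler_nat.
have m1 : Num.min eta 1 <= 1 by rewrite ge_min lexx orbT.
have m2 : Num.min eta 1 <= eta by rewrite ge_min lexx.
have Ile k : I (phi k) (phi k.+1) <= 1 / 2.
  have := hphi k k.+2; rewrite big_mkcond (bigD1_seq k.+1) ?mem_index_iota ?iota_uniq //=.
  rewrite gtn_eqF //= {1}/X; set S := \sum_(_ <- _ | _) _.
  have S0 : 0 <= S.
    by apply: sumr_ge0 => i _; case: ifP => // _; rewrite addr_ge0 ?cabs_ge0.
  by have := cabs_ge0 (ent2 (m (phi k)) (n (phi k.+1)) (n' (phi k.+1)) (l (phi k))); lra.
have inc k : (n (phi k) < n (phi k.+1))%N /\ (n' (phi k) < n' (phi k.+1))%N.
  have := Ile k; rewrite /I mphi ltnSn /=; case: ifP => [_|/negbT]; first by lra.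
  by rewrite negb_or -!ltnNge => /andP[].
have [a [aband ha _]] := partial_translation He dM dU (increasing_homo (fun k => (inc k).1))
  (increasing_homo (fun k => (inc k).2)) (fun k => qd (phi k)).
have [_ _ _ hU _] := HU.
(* The bad entry, of size [eta], is bounded by [eta / 4] for the image far from the diagonal,
   [eta / 8] for truncating the series and [eta / 2] for the other summands, a total below [eta]. *)
have e4 : 0 < eta / 4 by lra.
have [s hs] := uniform_roe_entries Hf (hU _ (band_uniform_roe aband)) e4.
pose k := Num.bound `|s|.
have sk : s < del (l (phi k)) (m (phi k)).
  apply: le_lt_trans (qs _); apply: le_trans (ler_norm s) _.
  apply: le_trans (ltW (archi_boundP (normr_ge0 s))) _.
  by rewrite ler_nat increasing_ge.
have h1 := hs _ _ sk.
have e8 : 0 < eta / 8 by lra.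
have [K hK] := ent2_series ha (m (phi k)) (l (phi k)) e8.
have := hK _ (leq_maxl K k.+1); set K' := maxn K k.+1.
rewrite (bigD1_seq k) ?mem_index_iota ?iota_uniq ?leq_maxr //=.
set A := nc f _ _ in h1 *; set B := ent2 _ _ _ _; set S := \sum_(_ <- _ | _) _ => h2.
have h3 : cabs S <= Num.min eta 1 / 2.
  apply: le_trans (hphi k K'); apply: le_trans (cabs_sum _ _ _) _.
  by apply: ler_sum => i _; rewrite /X lerDl.
have h4 : eta <= cabs B by exact: qe.
have : cabs B <= cabs A + cabs (A - (B + S)) + cabs S.
  rewrite {1}(_ : B = A + - (A - (B + S)) + - S); last by ring.
  by apply: (le_trans (cabsD _ _)); rewrite cabsN lerD2r;
    apply: (le_trans (cabsD _ _)); rewrite cabsN.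
by lra.
Qed.

End Implemented.

(** * Positive and regular operators *)

Section Regular.
Context {R : realType} {E : completeNormedModType R[i]}.
Variable e : nat -> E.
Hypothesis He : sym_basis e.

Definition rc m (x : E) : R := complex.Re (nc e m x).

Lemma rcE m x : real_span e x -> nc e m x = (rc m x)%:C.
Proof. by move=> /(real_spanP He)/(_ m)/real_Im0. Qed.

Lemma rcD m x y : rc m (x + y) = rc m x + rc m y.
Proof. by rewrite /rc ncD // ReD. Qed.

Lemma rcN m x : rc m (- x) = - rc m x.
Proof. by rewrite /rc ncN // ReN. Qed.

Lemma rcZ m (t : R) x : rc m (t%:C *: x) = t * rc m x.
Proof. by rewrite /rc ncZ // ReCM. Qed.

Lemma rc_sum (I : Type) (r : seq I) (P : pred I) (g : I -> E) m :
  rc m (\sum_(i <- r | P i) g i) = \sum_(i <- r | P i) rc m (g i).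
Proof. by rewrite /rc nc_sum // Re_sum. Qed.

Lemma rc_le m x : `|rc m x| <= rnorm x.
Proof. exact: le_trans (cabs_Re _) (nc_le He _ _). Qed.

Lemma real_span_lin (t : R) x y :
  real_span e x -> real_span e y -> real_span e (t%:C *: x + y).
Proof.
move=> /(real_spanP He) hx /(real_spanP He) hy; apply/(real_spanP He) => n.
by rewrite nc_lin // ImD ImCM hx hy mulr0 addr0.
Qed.

Lemma real_span0 : real_span e 0.
Proof. by apply/(real_spanP He) => n; rewrite nc0. Qed.

Lemma real_spanD x y : real_span e x -> real_span e y -> real_span e (x + y).
Proof. by move=> hx hy; have := @real_span_lin 1 _ _ hx hy; rewrite scale1r. Qed.

Lemma real_spanZ (t : R) x : real_span e x -> real_span e (t%:C *: x).
Proof. by move=> hx; rewrite -[_ *: _]addr0; apply: real_span_lin hx real_span0. Qed.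

Lemma real_spanN x : real_span e x -> real_span e (- x).
Proof. by move=> hx; have := @real_spanZ (-1) x hx; rewrite rmorphN rmorph1 scaleN1r. Qed.

Lemma real_span_nb l : real_span e (nb e l).
Proof. by apply/(real_spanP He) => n; rewrite nc_nb //; case: (n == l). Qed.

Lemma real_span_sum (I : Type) (r : seq I) (P : pred I) (g : I -> E) :
  (forall i, P i -> real_span e (g i)) -> real_span e (\sum_(i <- r | P i) g i).
Proof.
by move=> h; apply: (big_ind (real_span e)) => //; [exact: real_span0|exact: real_spanD].
Qed.

Lemma coneP x : positive_cone e x <-> real_span e x /\ forall n, 0 <= rc n x.
Proof.
rewrite (positive_coneP He); split=> [h|[hx h] n]; last by rewrite rcE // lecR.
have hx : real_span e x by apply/(real_spanP He) => n; exact: ger0_Im.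
by split=> // n; rewrite -lecR -rcE.
Qed.

Lemma cone_real x : positive_cone e x -> real_span e x. Proof. by case/coneP. Qed.

Lemma cone_nb l : positive_cone e (nb e l).
Proof. by apply/(positive_coneP He) => n; rewrite nc_nb // ler0n. Qed.

Lemma coneD x y : positive_cone e x -> positive_cone e y -> positive_cone e (x + y).
Proof.
move=> /coneP[hx h] /coneP[hy h']; apply/coneP; split=> [|n].
  exact: real_spanD.
by rewrite rcD addr_ge0.
Qed.

Lemma coneZ (t : R) x : 0 <= t -> positive_cone e x -> positive_cone e (t%:C *: x).
Proof.
move=> t0 /coneP[hx h]; apply/coneP; split=> [|n]; first exact: real_spanZ.
by rewrite rcZ mulr_ge0.
Qed.

Lemma cone_lim (u : nat -> E) x N : tends u x ->
  (forall k, (N <= k)%N -> positive_cone e (u k)) -> positive_cone e x.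
Proof.
move=> hu hk; apply/coneP; split=> [|n].
  apply/(real_spanP He) => n; apply/eqP/negPn/negP => h0.
  have h1 : 0 < `|complex.Im (nc e n x)| by rewrite normr_gt0.
  have [M hM] := nc_cvg He n hu h1.
  have /coneP[/(real_spanP He)/(_ n) h2 _] := hk _ (leq_maxr M N).
  have := le_lt_trans (cabs_Im _) (hM _ (leq_maxl M N)).
  by rewrite ImD ImN h2 add0r normrN ltxx.
apply/ler_addgt0Pr => eps e0; rewrite -lerBlDr sub0r.
have [M hM] := nc_cvg He n hu e0.
have /coneP[_ /(_ n) h2] := hk _ (leq_maxr M N).
have := le_lt_trans (cabs_Re _) (hM _ (leq_maxl M N)).
rewrite ReD ReN ltr_norml => /andP[_]; rewrite /rc in h2 *; lra.
Qed.

(** The modulus of [x] in the lattice complexification, through which estimates on positive vectors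
    reach complex ones. *)
Lemma abs_vector x : exists y, [/\ forall n, rc n y = cabs (nc e n x),
  positive_cone e y & rnorm y = rnorm x].
Proof.
have [|y hy] := nc_dom He (al := fun n => (cabs (nc e n x))%:C) (x := x).
  by move=> n; rewrite cabsR ger0_norm ?cabs_ge0.
exists y; split=> [n||]; first by rewrite /rc hy.
  by apply/(positive_coneP He) => n; rewrite hy lecR cabs_ge0.
by apply/eqP; rewrite eq_le; apply/andP; split; apply: (nc_mono He) => n;
  rewrite hy cabsR ger0_norm ?cabs_ge0.
Qed.

Section RealOperator.
Variable T : E -> E.
Hypothesis hT : real_operator e T.

Lemma rop_real x : real_span e x -> real_span e (T x). Proof. by case: hT => + _; apply. Qed.

Lemma rop_lin (t : R) x y : real_span e x -> real_span e y ->
  T (t%:C *: x + y) = t%:C *: T x + T y.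
Proof. by case: hT => _; apply. Qed.

Lemma rop0 : T 0 = 0.
Proof.
have := @rop_lin (-1) _ _ real_span0 real_span0.
by rewrite scaler0 addr0 rmorphN rmorph1 scaleN1r addNr.
Qed.

Lemma ropZ (t : R) x : real_span e x -> T (t%:C *: x) = t%:C *: T x.
Proof. by move=> hx; have := @rop_lin t _ _ hx real_span0; rewrite rop0 !addr0. Qed.

Lemma ropD x y : real_span e x -> real_span e y -> T (x + y) = T x + T y.
Proof. by move=> hx hy; have := @rop_lin 1 _ _ hx hy; rewrite !scale1r. Qed.

Lemma ropN x : real_span e x -> T (- x) = - T x.
Proof. by move=> hx; have := @ropZ (-1) x hx; rewrite rmorphN rmorph1 !scaleN1r. Qed.

Lemma ropB x y : real_span e x -> real_span e y -> T (x - y) = T x - T y.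
Proof. by move=> hx hy; rewrite ropD ?ropN //; exact: real_spanN. Qed.

Lemma rop_sum (s : seq nat) (t : nat -> R) :
  T (\sum_(l <- s) (t l)%:C *: nb e l) = \sum_(l <- s) (t l)%:C *: T (nb e l).
Proof.
elim: s => [|l s IH]; first by rewrite !big_nil rop0.
rewrite !big_cons rop_lin ?IH //; first exact: real_span_nb.
by apply: real_span_sum => i _; apply: real_spanZ; exact: real_span_nb.
Qed.

End RealOperator.

Lemma positive_cone_op S x : positive_operator e S -> positive_cone e x -> positive_cone e (S x).
Proof. by case=> _; apply. Qed.

(** Both [y + x] and [y - x] lie in the cone, hence so do their images. *)
Lemma positive_abs S x y m : positive_operator e S -> real_span e x ->
  real_span e y -> (forall n, `|rc n x| <= rc n y) -> `|rc m (S x)| <= rc m (S y).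
Proof.
move=> [hS pS] hx hy h.
have c1 : positive_cone e (y + x).
  apply/coneP; split; first exact: real_spanD.
  by move=> n; rewrite rcD; have := h n; rewrite ler_norml => /andP[]; lra.
have c2 : positive_cone e (y - x).
  apply/coneP; split; first by apply: real_spanD => //; exact: real_spanN.
  by move=> n; rewrite rcD rcN; have := h n; rewrite ler_norml => /andP[]; lra.
have /coneP[_ /(_ m)] := pS _ c1; have /coneP[_ /(_ m)] := pS _ c2.
by rewrite ropB // ropD // !rcD rcN ler_norml => h1 h2; apply/andP; split; lra.
Qed.

Lemma rnorm_real_mono x y : real_span e x -> real_span e y ->
  (forall n, `|rc n x| <= `|rc n y|) -> rnorm x <= rnorm y.
Proof. by move=> hx hy h; apply: (nc_mono He) => n; rewrite !rcE // !cabsR. Qed.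

Lemma exp2_lt (eps : R) : 0 < eps -> exists N, forall n, (N <= n)%N -> 2 ^- n < eps.
Proof.
move=> e0; exists (Num.bound eps^-1) => n hn.
rewrite invf_plt ?posrE ?exprn_gt0 //.
have h : eps^-1 < (Num.bound eps^-1)%:R by apply: archi_boundP; rewrite invr_ge0 ltW.
apply: lt_le_trans h _; apply: (@le_trans _ _ n%:R); first by rewrite ler_nat.
by rewrite -natrX ler_nat ltnW // ltn_expl.
Qed.

(* Otherwise a series of positive vectors of norm [2 ^- j] with images of norm
   at least [j] has a sum whose image dominates all of them. *)
Lemma positive_bounded S : positive_operator e S ->
  exists2 C : R, 0 <= C & forall x, real_span e x -> rnorm (S x) <= C * rnorm x.
Proof.
move=> pS; have [hS _] := pS; apply: contrapT => hcon.
have /choice[z hz] : forall j : nat, exists z,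
    [/\ positive_cone e z, rnorm z = 2 ^- j.+1 & j%:R < rnorm (S z)].
  move=> j; apply: contrapT => hj; apply: hcon.
  (* A vector violating this bound, replaced by its modulus and rescaled to norm [2 ^- j.+1], has an
     image of norm above [j]. *)
  exists (j%:R * 2 ^+ j.+1) => [|x hx]; first by rewrite mulr_ge0 // exprn_ge0.
  rewrite leNgt; apply/negP => hlt; apply: hj.
  have [y [hy cy ny]] := abs_vector x.
  have y0 : 0 < rnorm y.
    rewrite ny rnorm_gt0; apply/eqP => x0; move: hlt.
    by rewrite x0 rop0 // !rnorm0 mulr0 ltxx.
  have Sxy : rnorm (S x) <= rnorm (S y).
    apply: rnorm_real_mono; [exact: rop_real|exact/rop_real/cone_real|].
    move=> m; apply: le_trans (ler_norm _); apply: positive_abs => //; first exact: cone_real.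
    by move=> n; rewrite hy cabs_Re.
  exists ((2 ^- j.+1 / rnorm y)%:C *: y); split.
  - by apply: coneZ => //; rewrite divr_ge0 ?invr_ge0 ?exprn_ge0 ?rnorm_ge0.
  - rewrite rnormZ cabsR ger0_norm ?divr_ge0 ?invr_ge0 ?exprn_ge0 ?rnorm_ge0 //.
    by rewrite mulfVK // gt_eqF.
  - rewrite ropZ //; last exact: cone_real.
    rewrite rnormZ cabsR ger0_norm ?divr_ge0 ?invr_ge0 ?exprn_ge0 ?rnorm_ge0 //.
    rewrite mulrAC ltr_pdivlMr // [ltRHS]mulrC ltr_pdivlMr ?exprn_gt0 //.
    apply: lt_le_trans Sxy; apply: le_lt_trans hlt.
    by rewrite ny mulrAC.
have [zz hzz] : exists zz, tends (fun K => \sum_(0 <= j < K) z j) zz.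
  apply: cauchy_sym => eps /exp2_lt[N hN]; exists N => m n Nn nm.
  rewrite (big_cat_nat (leq0n n) nm) /= addrAC subrr add0r.
  apply: le_lt_trans (hN n Nn); apply: le_trans (rnorm_sum _ _ _) _.
  have -> : \sum_(n <= j < m) rnorm (z j) = \sum_(n <= j < m) 2 ^- j.+1.
    by apply: eq_bigr => j _; case: (hz j).
  have := sum_geometric (R := R) m.
  rewrite (big_cat_nat (leq0n n) nm) /= sum_geometric => h.
  have : 0 <= 2 ^- m :> R by rewrite invr_ge0 exprn_ge0.
  by move: h; set a := \sum_(_ <= _ < _) _ => h h'; lra.
have hle j : positive_cone e (zz - z j).
  have ht : tends (fun K => \sum_(0 <= j < K) z j + - z j) (zz + - z j).
    by apply: tendsD => // eps e0; exists 0%N => n _; rewrite subrr rnorm0.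
  apply: (cone_lim (N := j.+1) ht) => K jK.
  rewrite (bigD1_seq j) ?mem_index_iota ?iota_uniq //= addrAC subrr add0r.
  apply: (big_ind (positive_cone e)) => [||i _]; last by case: (hz i).
    by apply/coneP; split=> [|n]; [exact: real_span0|rewrite /rc nc0].
  exact: coneD.
have czz : positive_cone e zz.
  by rewrite -[zz](subrK (z 0%N)); apply: coneD; [exact: hle|case: (hz 0%N)].
have := archi_boundP (rnorm_ge0 (S zz)); set n := Num.bound _.
have [cz _ hn] := hz n.
apply/negP; rewrite -leNgt; apply: le_trans (ltW hn) _.
apply: rnorm_real_mono; try exact/rop_real/cone_real.
move=> m; have /coneP[_ h] := positive_cone_op pS cz.
have /coneP[_ h'] := positive_cone_op pS (hle n).
rewrite ger0_norm //; apply: le_trans (ler_norm _).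
have := h' m; rewrite ropB //; try exact: cone_real.
by rewrite rcD rcN; lra.
Qed.

Lemma regular_bounded T : regular_real e T ->
  exists2 C : R, 0 <= C & forall x, real_span e x -> rnorm (T x) <= C * rnorm x.
Proof.
move=> [_ [S1 [S2 [/positive_bounded[C1 C10 h1] /positive_bounded[C2 C20 h2] h]]]].
exists (C1 + C2) => [|x hx]; first by rewrite addr_ge0.
rewrite h // mulrDl; apply: le_trans (rnormB _ _) _.
by apply: lerD; [exact: h1|exact: h2].
Qed.

(** Rows converge on every vector of the real span, so operators are compared entry by entry; this
    is how suprema in the lattice of regular operators are computed. *)
Definition has_matrix T (A : nat -> nat -> R) : Prop :=
  real_operator e T /\ forall x m, real_span e x ->
    (fun k => \sum_(0 <= l < k) A m l * rc l x) @ \oo --> rc m (T x).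

Lemma bounded_has_matrix T (C : R) : real_operator e T -> 0 <= C ->
  (forall x, real_span e x -> rnorm (T x) <= C * rnorm x) ->
  has_matrix T (fun m l => rc m (T (nb e l))).
Proof.
move=> hT C0 hC; split=> // x m hx; apply/cvgrPdist_lt => eps e0.
have C1 : 0 < C + 1 by lra.
have [N hN] := nc_expand He x (divr_gt0 e0 C1).
exists N => // k /= /hN; rewrite ltr_pdivlMr //; apply: le_lt_trans.
have -> : \sum_(0 <= i < k) nc e i x *: nb e i = \sum_(0 <= i < k) (rc i x)%:C *: nb e i.
  by apply: eq_bigr => i _; rewrite rcE.
set S := \sum_(0 <= i < k) (rc i x)%:C *: nb e i.
have hS : real_span e S.
  by apply: real_span_sum => i _; apply: real_spanZ; exact: real_span_nb.
have -> : \sum_(0 <= l < k) rc m (T (nb e l)) * rc l x = rc m (T S).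
  rewrite /S rop_sum // rc_sum; apply: eq_bigr => l _.
  by rewrite rcZ mulrC.
rewrite -rcN -rcD -ropB //; apply: le_trans (rc_le _ _) _.
apply: le_trans (hC _ _) _; first by apply: real_spanD => //; exact: real_spanN.
by rewrite rnormC mulrC ler_wpM2l ?rnorm_ge0 //; lra.
Qed.

Lemma regular_has_matrix T : regular_real e T ->
  has_matrix T (fun m l => rc m (T (nb e l))).
Proof.
by move=> rT; have [C C0 hC] := regular_bounded rT; case: rT => hT _;
  exact: bounded_has_matrix C0 hC.
Qed.

Lemma has_matrix_le T T' A A' : has_matrix T A -> has_matrix T' A' ->
  (forall m l, A m l <= A' m l) -> operator_le e T T'.
Proof.
move=> [hT h] [hT' h'] hA x cx; have /coneP[hx px] := cx.
apply/coneP; split=> [|m].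
  by apply: real_spanD; [exact: rop_real|apply: real_spanN; exact: rop_real].
rewrite rcD rcN subr_ge0; apply: (ler_cvg_to (h x m hx) (h' x m hx)).
by apply: nearW => k; apply: ler_sum => l _; rewrite ler_wpM2r.
Qed.

End Regular.

(** * Suprema of order bounded families of operators *)

Section Supremum.
Context {R : realType} {E : completeNormedModType R[i]}.
Variable e : nat -> E.
Hypothesis He : sym_basis e.

Lemma has_matrixD T T' A A' : has_matrix e T A -> has_matrix e T' A' ->
  has_matrix e (fun x => T x + T' x) (fun m l => A m l + A' m l).
Proof.
move=> [hT h] [hT' h']; split.
  split=> [x hx|c x y hx hy]; first by apply: (real_spanD He); exact: rop_real.
  by rewrite (rop_lin hT) // (rop_lin hT') // scalerDr addrACA.
move=> x m hx; rewrite rcD //.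
under eq_fun do under eq_bigr do rewrite mulrDl.
by under eq_fun do rewrite big_split /=; apply: cvgD; [exact: h|exact: h'].
Qed.

Lemma has_matrix_positive T A : has_matrix e T A -> (forall m l, 0 <= A m l) ->
  positive_operator e T.
Proof.
move=> [hT h] hA; split=> // x /(coneP He)[hx px]; apply/(coneP He).
split=> [|m]; first exact: rop_real.
apply: (ler_cvg_to (cvg_cst (0 : R)) (h x m hx)); apply: nearW => k.
by apply: sumr_ge0 => l _; rewrite mulr_ge0.
Qed.

Lemma positive_has_matrix S : positive_operator e S -> has_matrix e S (fun m l => rc e m (S (nb e l))).
Proof.
move=> pS; have [C C0 hC] := positive_bounded He pS.
by case: pS => hS _; exact: bounded_has_matrix C0 hC.
Qed.

(** On [x] the rows converge absolutely, being dominated by the rows of [S] at the modulus [z] of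
    [x]. The limits are dominated by the coordinates of [S z], so they are the coordinates of a
    vector. *)
Lemma dominated_has_matrix S (A : nat -> nat -> R) : positive_operator e S ->
  (forall m l, `|A m l| <= rc e m (S (nb e l))) -> exists M, has_matrix e M A.
Proof.
move=> pS hA; have [hS _] := pS.
have /choice[M hM] : forall x, exists y, real_span e x -> real_span e y /\
    forall m, (fun k => \sum_(0 <= l < k) A m l * rc e l x) @ \oo --> rc e m y.
  move=> x; have [hx|hx] := pselect (real_span e x); last by exists 0.
  have [z [hz cz _]] := abs_vector He x.
  have rSz m : rc e m (S z) <= cabs (nc e m (S z)).
    exact: le_trans (ler_norm _) (cabs_Re _).
  have bd m k : \sum_(0 <= l < k) `|A m l * rc e l x| <= rc e m (S z).
    apply: (@le_trans _ _ (rc e m (S (\sum_(0 <= l < k) (rc e l z)%:C *: nb e l)))).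
      rewrite (rop_sum He hS) rc_sum //; apply: ler_sum => l _.
      rewrite rcZ // normrM mulrC; apply: ler_pM => //.
      by rewrite hz cabs_Re.
    apply: le_trans (ler_norm _) _; apply: (positive_abs He) => //; try exact: (cone_real He).
      by apply: (real_span_sum He) => i _; apply: (real_spanZ He); exact: real_span_nb.
    move=> n; have -> : \sum_(0 <= l < k) (rc e l z)%:C *: nb e l = \sum_(0 <= l < k) nc e l z *: nb e l.
      by apply: eq_bigr => l _; rewrite (rcE He) //; exact: (cone_real He).
    have /(coneP He)[_ /(_ n) z0] := cz.
    by rewrite {1}/rc nc_partial //; case: ifP => _; rewrite ?normr0 // ger0_norm.
  pose s m k := \sum_(0 <= l < k) A m l * rc e l x.
  have sle m k : `|s m k| <= rc e m (S z) by exact: le_trans (ler_norm_sum _ _ _) (bd m k).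
  have cv m : cvgn (s m).
    have : cvgn (fun k => \sum_(0 <= l < k) `|A m l * rc e l x|).
      apply: nondecreasing_is_cvgn; last by exists (rc e m (S z)) => _ [k _ <-]; exact: bd.
      by apply/nondecreasing_seqP => k; rewrite big_nat_recr //= lerDl normr_ge0.
    exact: (@normed_cvg _ _ (fun l => A m l * rc e l x)).
  have lim_le m : cabs (limn (s m))%:C <= cabs (nc e m (S z)).
    rewrite cabsR; apply: le_trans (rSz m); rewrite ler_norml; apply/andP; split.
      by apply: limr_ge => //; apply: nearW => k; have := sle m k; rewrite ler_norml => /andP[].
    by apply: limr_le => //; apply: nearW => k; exact: le_trans (ler_norm _) (sle m k).
  have [y hy] := nc_dom He lim_le.
  exists y => _; split=> [|m]; first by apply/(real_spanP He) => n; rewrite hy.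
  by rewrite {2}/rc hy /=; exact: cv.
exists M; split=> [|x m /hM[_]]; last by apply.
split=> [x /hM[] //|c x y hx hy].
have hxy := real_span_lin He (t := c) hx hy.
have [hMx cx] := hM _ hx; have [hMy cy] := hM _ hy; have [hMxy cxy] := hM _ hxy.
apply: (nc_ext He) => m; rewrite nc_lin // !(rcE He) // -rmorphM -rmorphD; congr (_%:C).
apply: (cvg_unique _ (cxy m)) => //.
rewrite (_ : (fun k => _) = (fun k => c * (\sum_(0 <= l < k) A m l * rc e l x) +
    \sum_(0 <= l < k) A m l * rc e l y)).
  by apply: cvgD; [apply: cvgMr; exact: cx|exact: cy].
apply/funext => k; rewrite mulr_sumr -big_split /=; apply: eq_bigr => l _.
by rewrite rcD // rcZ //; ring.
Qed.

Lemma matrix_regular S M (A : nat -> nat -> R) : positive_operator e S ->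
  (forall m l, `|A m l| <= rc e m (S (nb e l))) -> has_matrix e M A -> regular_real e M.
Proof.
move=> pS hA hM; split; first by case: hM.
exists (fun x => M x + S x), S; split=> // [|x _]; last by rewrite addrK.
apply: (has_matrix_positive (has_matrixD hM (positive_has_matrix pS))) => m l.
by have := hA m l; rewrite ler_norml => /andP[]; lra.
Qed.

Lemma operator_le_entry T T' : operator_le e T T' ->
  forall m l, rc e m (T (nb e l)) <= rc e m (T' (nb e l)).
Proof.
move=> h m l; have /(coneP He)[_ /(_ m)] := h _ (cone_nb He l).
by rewrite rcD // rcN // subr_ge0.
Qed.

(** The entrywise supremum is dominated by the entries of [S], hence is the matrix of a regular
    operator, and upper bounds are recognized on entries. *)
Lemma operator_sup_exists (A : set (E -> E)) S : A !=set0 -> positive_operator e S ->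
  (forall T, A T -> [/\ regular_real e T, operator_le e T S
                      & operator_le e (fun x => - S x) T]) ->
  is_operator_sup e A (operator_sup e A).
Proof.
move=> [T0 AT0] pS hA.
have bd T m l : A T -> `|rc e m (T (nb e l))| <= rc e m (S (nb e l)).
  move=> /hA[_ h1 h2]; rewrite ler_norml (operator_le_entry h1) andbT.
  by have := operator_le_entry h2 m l; rewrite rcN.
pose B m l := sup [set rc e m (T (nb e l)) | T in A].
have ubB m l : has_ubound [set rc e m (T (nb e l)) | T in A].
  by exists (rc e m (S (nb e l))) => _ [T AT <-]; exact: le_trans (ler_norm _) (bd _ _ _ AT).
have leB T m l : A T -> rc e m (T (nb e l)) <= B m l.
  by move=> AT; apply: ub_le_sup => //; exists T.
have Ble (C : R) m l : (forall T, A T -> rc e m (T (nb e l)) <= C) -> B m l <= C.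
  by move=> h; apply: ge_sup => [|_ [T AT <-]]; [exists (rc e m (T0 (nb e l))), T0|exact: h].
have hB m l : `|B m l| <= rc e m (S (nb e l)).
  rewrite ler_norml; apply/andP; split.
    apply: le_trans (leB _ _ _ AT0); have := bd _ m l AT0.
    by rewrite ler_norml => /andP[].
  by apply: Ble => T AT; exact: le_trans (ler_norm _) (bd _ _ _ AT).
have [M hM] := dominated_has_matrix pS hB.
suff : is_operator_sup e A M by move=> h; apply: (@xgetPex _ 0 (is_operator_sup e A)); exists M.
split=> [|T AT|S' rS' hS'].
- exact: matrix_regular hB hM.
- have [rT _ _] := hA _ AT.
  apply: (has_matrix_le He (regular_has_matrix He rT) hM) => m l; exact: leB.
- apply: (has_matrix_le He hM (regular_has_matrix He rS')) => m l.
  by apply: Ble => T /hS' h; exact: operator_le_entry.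
Qed.

End Supremum.

(** * The modulus of a regular operator *)

Section Modulus.
Context {R : realType} {E : completeNormedModType R[i]}.
Variable e : nat -> E.
Hypothesis He : sym_basis e.

Lemma re_im_exist y : exists u v, [/\ real_span e u, real_span e v & y = u + 'i *: v].
Proof.
have [|u hu] := nc_dom He (al := fun n => (complex.Re (nc e n y))%:C) (x := y).
  by move=> n; rewrite cabsR cabs_Re.
have [|v hv] := nc_dom He (al := fun n => (complex.Im (nc e n y))%:C) (x := y).
  by move=> n; rewrite cabsR cabs_Im.
exists u, v; split; try by apply/(real_spanP He) => n; rewrite ?hu ?hv.
by apply: (nc_ext He) => n; rewrite ncD // ncZ // hu hv -complexiE -complexE.
Qed.

Lemma re_im_coords y u v n : real_span e u -> real_span e v -> y = u + 'i *: v ->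
  rc e n u = complex.Re (nc e n y) /\ rc e n v = complex.Im (nc e n y).
Proof.
move=> hu hv ->; rewrite ncD // ncZ // !(rcE He) // -complexiE /=.
by split; ring.
Qed.

Lemma re_partP y : real_span e (re_part e y) /\
  forall n, rc e n (re_part e y) = complex.Re (nc e n y).
Proof.
have [u [v [hu hv yE]]] := re_im_exist y.
have [h1 [v' h2 h3]] : [set u | real_span e u /\
    exists2 v, real_span e v & y = u + 'i *: v] (re_part e y).
  by apply: (@xgetPex _ 0); exists u; split=> //; exists v.
by split=> // n; have [] := re_im_coords n h1 h2 h3.
Qed.

Lemma im_partP y : real_span e (im_part e y) /\
  forall n, rc e n (im_part e y) = complex.Im (nc e n y).
Proof.
have [u [v [hu hv yE]]] := re_im_exist y.
have [h1 [u' h2 h3]] : [set v | real_span e v /\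
    exists2 u, real_span e u & y = u + 'i *: v] (im_part e y).
  by apply: (@xgetPex _ 0); exists v; split=> //; exists u.
by split=> // n; have [] := re_im_coords n h2 h1 h3.
Qed.

Lemma real_ext x y : real_span e x -> real_span e y ->
  (forall n, rc e n x = rc e n y) -> x = y.
Proof. by move=> hx hy h; apply: (nc_ext He) => n; rewrite !(rcE He) // h. Qed.

Lemma re_part_real_operator (T : E -> E) : linear T -> real_operator e (re_part e \o T).
Proof.
move=> lT; split=> [x _|c x y _ _]; first by case: (re_partP (T x)).
have [h1 r1] := re_partP (T (c%:C *: x + y)).
have [h2 r2] := re_partP (T x); have [h3 r3] := re_partP (T y).
apply: real_ext => // [|n]; first exact: real_span_lin.
by rewrite rcD // rcZ // r1 r2 r3 lT nc_lin // ReD ReCM.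
Qed.

Lemma im_part_real_operator (T : E -> E) : linear T -> real_operator e (im_part e \o T).
Proof.
move=> lT; split=> [x _|c x y _ _]; first by case: (im_partP (T x)).
have [h1 r1] := im_partP (T (c%:C *: x + y)).
have [h2 r2] := im_partP (T x); have [h3 r3] := im_partP (T y).
apply: real_ext => // [|n]; first exact: real_span_lin.
by rewrite rcD // rcZ // r1 r2 r3 lT nc_lin // ImD ImCM.
Qed.

Lemma real_operator_lin (s t : R) P Q : real_operator e P -> real_operator e Q ->
  real_operator e (fun x => s%:C *: P x + t%:C *: Q x).
Proof.
move=> hP hQ; split=> [x hx|c x y hx hy].
  by apply: (real_span_lin He); [|apply: (real_spanZ He)]; exact: rop_real.
rewrite (rop_lin hP) // (rop_lin hQ) // !scalerDr !scalerA [s%:C * _]mulrC [t%:C * _]mulrC.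
by rewrite addrACA.
Qed.

Lemma positive_operatorD S T : positive_operator e S -> positive_operator e T ->
  positive_operator e (fun x => S x + T x).
Proof.
move=> [hS pS] [hT pT]; split=> [|x cx]; last by apply: (coneD He); [exact: pS|exact: pT].
have [h1 h2] := real_operator_lin 1 1 hS hT.
by split=> [x hx|c x y hx hy]; [have := h1 _ hx|have := h2 c _ _ hx hy]; rewrite !scale1r.
Qed.

Lemma between_regular S T : positive_operator e S -> real_operator e T ->
  operator_le e (fun x => - S x) T -> regular_real e T.
Proof.
move=> pS hT h; split=> //; exists (fun x => T x + S x), S; split=> // [|x _].
  split=> [|x /h]; last by rewrite opprK.
  have [hS _] := pS; have [h1 h2] := real_operator_lin 1 1 hT hS.
  by split=> [x hx|c x y hx hy]; [have := h1 _ hx|have := h2 c _ _ hx hy]; rewrite !scale1r.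
by rewrite addrK.
Qed.

(* The operators [cos t * T_r + sin t * T_c] all lie between [- S] and [S]. *)
Definition rotation (T : E -> E) (t : R) : E -> E :=
  fun x => (cos t)%:C *: re_part e (T x) + (sin t)%:C *: im_part e (T x).

Lemma rotation_bound T : regular_operator e T -> exists2 S, positive_operator e S &
  forall t, [/\ real_operator e (rotation T t), operator_le e (rotation T t) S
              & operator_le e (fun x => - S x) (rotation T t)].
Proof.
move=> [_ [hr [S1 [S2 [p1 p2 E1]]]] [hc [S3 [S4 [p3 p4 E2]]]]].
(* The sum of all four positive parts dominates every rotation at once, because cosine and sine are
   at most 1 in absolute value. *)
exists (fun x => (S1 x + S2 x) + (S3 x + S4 x)).
  by do 2?apply: positive_operatorD.
move=> t; have hR := real_operator_lin (cos t) (sin t) hr hc.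
have key x m : positive_cone e x ->
    `|rc e m (rotation T t x)| <= rc e m ((S1 x + S2 x) + (S3 x + S4 x)).
  move=> cx; have hx := cone_real He cx.
  rewrite /rotation -/((re_part e \o T) x) -/((im_part e \o T) x) E1 // E2 //.
  rewrite !(rcD He) !(rcZ He) !(rcD He) !(rcN He).
  have /(coneP He)[_ /(_ m)] := positive_cone_op p1 cx.
  have /(coneP He)[_ /(_ m)] := positive_cone_op p2 cx.
  have /(coneP He)[_ /(_ m)] := positive_cone_op p3 cx.
  have /(coneP He)[_ /(_ m)] := positive_cone_op p4 cx.
  set a := rc e m (S1 x); set b := rc e m (S2 x); set c := rc e m (S3 x); set d := rc e m (S4 x).
  move=> d0 c0 b0 a0; apply: le_trans (ler_normD _ _) _; rewrite !normrM.
  have cos1 : `|cos t| <= 1 by rewrite ler_norml cos_geN1 cos_le1.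
  have sin1 : `|sin t| <= 1 by rewrite ler_norml sin_geN1 sin_le1.
  have ab : `|a - b| <= a + b by rewrite ler_norml; apply/andP; split; lra.
  have cd : `|c - d| <= c + d by rewrite ler_norml; apply/andP; split; lra.
  apply: lerD.
    by apply: le_trans (ler_piMl _ cos1) ab.
  by apply: le_trans (ler_piMl _ sin1) cd.
have hreal x : positive_cone e x -> real_span e (rotation T t x).
  by move=> /(cone_real He); case: hR => + _; apply.
have hS x : positive_cone e x -> real_span e ((S1 x + S2 x) + (S3 x + S4 x)).
  move=> cx; apply: (cone_real He); do 2?apply: (coneD He); exact: positive_cone_op cx.
split=> // x cx; apply/(coneP He); split=> [|m].
- by apply: (real_spanD He); [exact: hS|apply: (real_spanN He); exact: hreal].
- by rewrite rcD // rcN // subr_ge0; exact: le_trans (ler_norm _) (key x m cx).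
- by apply: (real_spanD He); [exact: hreal|rewrite opprK; exact: hS].
- rewrite rcD // opprK -lerBlDr sub0r lerNl.
  by apply: le_trans (key x m cx); rewrite -normrN ler_norm.
Qed.

Lemma operator_le_trans T1 T2 T3 : operator_le e T1 T2 -> operator_le e T2 T3 ->
  operator_le e T1 T3.
Proof.
move=> h1 h2 x cx; have -> : T3 x - T1 x = (T3 x - T2 x) + (T2 x - T1 x).
  by rewrite addrA subrK.
by apply: (coneD He); [exact: h2|exact: h1].
Qed.

Lemma operator_leN T1 T2 : operator_le e T1 T2 ->
  operator_le e (fun x => - T2 x) (fun x => - T1 x).
Proof. by move=> h x cx; rewrite opprK addrC; exact: h. Qed.

Lemma positive_regular S : positive_operator e S -> regular_real e S.
Proof.
move=> pS; have [hS _] := pS; apply: (between_regular pS hS) => x cx.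
by rewrite opprK; apply: (coneD He); exact: positive_cone_op cx.
Qed.

Lemma operator_abs_sup T t : regular_operator e T ->
  is_operator_sup e [set rotation T t; - rotation T t] (operator_abs e (rotation T t)).
Proof.
move=> /rotation_bound[S pS /(_ t)[h1 h2 h3]].
have h4 := operator_leN h2; have h5 := operator_leN h3.
have h6 : real_operator e (fun x => - rotation T t x).
  have [h7 h8] := real_operator_lin (-1) 0 h1 h1.
  split=> [x hx|c x y hx hy]; [have := h7 _ hx|have := h8 c _ _ hx hy];
  by rewrite !rmorphN !rmorph1 !rmorph0 !scaleN1r !scale0r !addr0.
apply: (operator_sup_exists He (S := S)) => //; first by exists (rotation T t); left.
move=> Q [->|->]; split=> //; try exact: between_regular pS _ _.
by move=> x cx; have := h5 x cx; rewrite opprK.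
Qed.

Lemma modulus_sup T : regular_operator e T ->
  is_operator_sup e [set operator_abs e (rotation T t) | t in [set t : R | 0 <= t <= 2 * pi]]
    (modulus e T).
Proof.
move=> rT; have [S pS hS] := rotation_bound rT.
apply: (operator_sup_exists He (S := S)) => //.
  by exists (operator_abs e (rotation T 0)), 0 => //=; rewrite lexx mulr_ge0 ?pi_ge0.
move=> _ [t _ <-]; have [rA ubA lA] := operator_abs_sup t rT.
have [h1 h2 h3] := hS t; split=> //.
  apply: lA => [|Q [->|->]] //; first exact: positive_regular.
  by move=> x cx; have := operator_leN h3 cx; rewrite opprK.
apply: operator_le_trans h3 _; apply: ubA; by left.
Qed.

(** The angles 0 and [pi / 2] bound the real and the imaginary part separately. This costs the
    factor 2, which all later comparisons with the regular norm inherit. *)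
Lemma modulus_entry T m l : regular_operator e T ->
  cabs (nc e m (T (nb e l))) <= 2 * rc e m (modulus e T (nb e l)).
Proof.
move=> rT; have [rM ubM _] := modulus_sup rT.
have key (t : R) : 0 <= t <= 2 * pi ->
    `|rc e m (rotation T t (nb e l))| <= rc e m (modulus e T (nb e l)).
  move=> ht; have [_ ubA _] := operator_abs_sup t rT.
  have hA : operator_le e (operator_abs e (rotation T t)) (modulus e T) by apply: ubM; exists t.
  have h1 := operator_le_entry He (operator_le_trans (ubA _ (or_introl erefl)) hA) m l.
  have h2 := operator_le_entry He (operator_le_trans (ubA _ (or_intror erefl)) hA) m l.
  rewrite ler_norml h1 andbT lerNl; apply: le_trans h2.
  by rewrite -rcN.
have pi0 := pi_ge0 R.
have h1 : `|complex.Re (nc e m (T (nb e l)))| <= rc e m (modulus e T (nb e l)).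
  have := key 0; rewrite lexx mulr_ge0 // => /(_ isT).
  rewrite /rotation cos0 sin0 rmorph1 rmorph0 scale1r scale0r addr0.
  by have [_ ->] := re_partP (T (nb e l)).
have h2 : `|complex.Im (nc e m (T (nb e l)))| <= rc e m (modulus e T (nb e l)).
  have := key (pi / 2); rewrite /rotation cos_pihalf sin_pihalf => h; apply: le_trans (h _); last by lra.
  rewrite rmorph1 rmorph0 scale1r scale0r add0r.
  by have [_ ->] := im_partP (T (nb e l)).
by apply: le_trans (cabs_le_ReIm _) _; lra.
Qed.

Lemma modulus_bound T x : regular_operator e T -> real_span e x ->
  rnorm (modulus e T x) <= regular_norm e T * rnorm x.
Proof.
move=> rT hx; have [rM _ _] := modulus_sup rT; have [hM _] := rM.
have [C C0 hC] := regular_bounded He rM.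
apply: (opnorm_on_ge (fun t y => @real_spanZ _ _ _ He t y) _ C0 hC hx) => t y hy.
exact: (ropZ He hM).
Qed.

(** With [z] the modulus of [T] at a positive vector, the regular norm controls sums of absolute
    values of entries, which no choice of phases can enlarge. *)
Lemma regular_norm_dominates T (t : nat -> R) L : regular_operator e T ->
  (forall l, 0 <= t l) -> exists2 z,
  rnorm z <= regular_norm e T * rnorm (\sum_(0 <= l < L) (t l)%:C *: nb e l)
  & forall m, \sum_(0 <= l < L) t l * cabs (nc e m (T (nb e l))) <= 2 * cabs (nc e m z).
Proof.
move=> rT t0; set x := \sum_(_ <= _ < _) _.
have hx : real_span e x.
  by apply: (real_span_sum He) => i _; apply: (real_spanZ He); exact: real_span_nb.
have [[hM _] _ _] := modulus_sup rT.
exists (modulus e T x) => [|m]; first exact: modulus_bound.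
apply: (@le_trans _ _ (2 * rc e m (modulus e T x))); last first.
  by rewrite ler_pM2l //; exact: le_trans (ler_norm _) (cabs_Re _).
rewrite /x (rop_sum He hM) rc_sum // mulr_sumr; apply: ler_sum => l _.
by rewrite rcZ // mulrCA ler_wpM2l //; exact: modulus_entry.
Qed.

End Modulus.

(** * The regular Roe algebra and Schur multiplication *)

Section RegularRoe.
Context {R : realType} {E : completeNormedModType R[i]}.
Variables (e : nat -> E) (d : nat -> nat -> R).
Hypotheses (He : sym_basis e) (dM : metric_on_nat d) (dU : uniformly_locally_finite d).

Lemma partial_le x N : rnorm (\sum_(0 <= i < N) nc e i x *: nb e i) <= rnorm x.
Proof.
apply: (nc_mono He) => n; rewrite nc_partial //; case: ifP => // _.
by rewrite cabs0 cabs_ge0.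
Qed.

Lemma bounded_linear_tends (F : completeNormedModType R[i]) (T : E -> F) u x :
  bounded_linear T -> tends u x -> tends (T \o u) (T x).
Proof.
move=> [lT [C C0 hC]] hu eps e0; have C1 : 0 < C + 1 by lra.
have [N hN] := hu _ (divr_gt0 e0 C1).
exists N => n /hN; rewrite ltr_pdivlMr // => h.
rewrite /= -(linB _ _ lT); apply: le_lt_trans h; apply: le_trans (hC _) _.
by rewrite mulrC ler_wpM2l ?rnorm_ge0 //; lra.
Qed.

Lemma bounded_real_part (T : E -> E) :
  bounded_linear T -> has_matrix e (re_part e \o T) (fun m l => complex.Re (nc e m (T (nb e l)))).
Proof.
move=> [lT [C C0 hC]].
have h : forall x, rnorm (re_part e (T x)) <= C * rnorm x.
  move=> x; apply: le_trans (hC x); apply: (nc_mono He) => n.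
  by have [h1 h2] := re_partP He (T x); rewrite (rcE He) // h2 cabsR cabs_Re.
have := bounded_has_matrix He (re_part_real_operator He lT) C0 (fun x _ => h x).
congr (has_matrix e _ _); apply/funext => m; apply/funext => l.
by have [_ /= ->] := re_partP He (T (nb e l)).
Qed.

Lemma bounded_imaginary_part (T : E -> E) :
  bounded_linear T -> has_matrix e (im_part e \o T) (fun m l => complex.Im (nc e m (T (nb e l)))).
Proof.
move=> [lT [C C0 hC]].
have h : forall x, rnorm (im_part e (T x)) <= C * rnorm x.
  move=> x; apply: le_trans (hC x); apply: (nc_mono He) => n.
  by have [h1 h2] := im_partP He (T x); rewrite (rcE He) // h2 cabsR cabs_Im.
have := bounded_has_matrix He (im_part_real_operator He lT) C0 (fun x _ => h x).
congr (has_matrix e _ _); apply/funext => m; apply/funext => l.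
by have [_ /= ->] := im_partP He (T (nb e l)).
Qed.

(** The entrywise modulus of a band matrix is again a band matrix with bounded entries, hence a
    positive operator dominating the real and the imaginary part. *)
Lemma band_regular b : band_operator d e b -> regular_operator e b.
Proof.
move=> hb; have [bb [s _ hs]] := band_operator_entries He hb.
have [lb [K K0 hK]] := bb; have [C C0 hC] := band_matrix_operator He dM dU s.
have [|m l h|S [lS bS eS]] := hC (fun m l => (cabs (nc e m (b (nb e l))))%:C) K.
- by move=> m l; rewrite cabsR ger0_norm ?cabs_ge0 //; exact: (entry_le He He).
- by rewrite hs // cabs0.
have bdS : bounded_linear S by split=> //; exists (C * K) => //; rewrite mulr_ge0 // ltW.
have hP := bounded_real_part bdS.
have pP : positive_operator e (re_part e \o S).
  by apply: (has_matrix_positive He hP) => m l; rewrite eS /= cabs_ge0.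
have rP m l : rc e m ((re_part e \o S) (nb e l)) = cabs (nc e m (b (nb e l))).
  by have [_ /= ->] := re_partP He (S (nb e l)); rewrite eS.
split; first by case: hb.
  by apply: (matrix_regular He pP _ (bounded_real_part bb)) => m l; rewrite rP cabs_Re.
by apply: (matrix_regular He pP _ (bounded_imaginary_part bb)) => m l; rewrite rP cabs_Im.
Qed.

Lemma regular_realB S T : regular_real e S -> regular_real e T ->
  regular_real e (fun x => S x - T x).
Proof.
move=> [hS [S1 [S2 [p1 p2 E1]]]] [hT [S3 [S4 [p3 p4 E2]]]]; split.
  have [h1 h2] := real_operator_lin He 1 (-1) hS hT.
  by split=> [x hx|c x y hx hy]; [have := h1 _ hx|have := h2 c _ _ hx hy];
    rewrite !rmorphN !rmorph1 !scaleN1r !scale1r.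
exists (fun x => S1 x + S4 x), (fun x => S2 x + S3 x).
split=> [||x hx]; try exact: (positive_operatorD He).
by rewrite E1 // E2 // opprB addrACA opprD.
Qed.

Lemma regular_operatorB a b : regular_operator e a -> regular_operator e b ->
  regular_operator e (a - b).
Proof.
move=> [/bounded_operatorP ba ra ca] [/bounded_operatorP bb rb cb]; split.
- exact/bounded_operatorP/bounded_linear_sub.
- have -> : re_part e \o (a - b) = fun x => re_part e (a x) - re_part e (b x).
    apply/funext => x; rewrite /= !fctE.
    have [h1 k1] := re_partP He (a x - b x); have [h2 k2] := re_partP He (a x).
    have [h3 k3] := re_partP He (b x).
    apply: (real_ext He) => // [|n]; first by apply: real_spanD => //; exact: real_spanN.
    by rewrite rcD // rcN // k1 k2 k3 ncB // ReD ReN.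
  exact: regular_realB.
- have -> : im_part e \o (a - b) = fun x => im_part e (a x) - im_part e (b x).
    apply/funext => x; rewrite /= !fctE.
    have [h1 k1] := im_partP He (a x - b x); have [h2 k2] := im_partP He (a x).
    have [h3 k3] := im_partP He (b x).
    apply: (real_ext He) => // [|n]; first by apply: real_spanD => //; exact: real_spanN.
    by rewrite rcD // rcN // k1 k2 k3 ncB // ImD ImN.
  exact: regular_realB.
Qed.

(** The modulus is picked by [xget] and known through its order property alone, so its vanishing on
    the real span is derived from two inequalities. This is used for the difference of a band
    operator with itself. *)
Lemma regular_norm_eq0 T : regular_operator e T -> (forall x, T x = 0) ->
  regular_norm e T <= 0.
Proof.
move=> rT T0.
have z0 : real_operator e (fun=> 0 : E).
  split=> [x _|c x y _ _]; first exact: real_span0.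
  by rewrite scaler0 addr0.
have p0 : positive_operator e (fun=> 0 : E).
  split=> // x _; apply/(positive_coneP He) => n; by rewrite nc0.
have r0 : regular_real e (fun=> 0 : E) by exact: positive_regular.
have rot0 t x : rotation e T t x = 0.
  have [h1 k1] := re_partP He (T x); have [h2 k2] := im_partP He (T x).
  apply: (nc_ext He) => n; rewrite /rotation nc_lin // ncZ // nc0 // !(rcE He) // k1 k2 T0.
  by rewrite nc0 //= !mulr0 addr0.
have c0 : positive_cone e 0 by apply/(positive_coneP He) => n; rewrite nc0.
have [rM ubM lM] := modulus_sup He rT.
have Mle : operator_le e (modulus e T) (fun=> 0).
  apply: lM => // _ [t _ <-]; have [_ _ lA] := operator_abs_sup He t rT.
  by apply: lA => // Q [->|->] x cx; rewrite ?fctE rot0 !oppr0 addr0.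
have Mge : operator_le e (fun=> 0) (modulus e T).
  have [_ ubA _] := operator_abs_sup He 0 rT.
  have h := ubA _ (or_introl erefl).
  have h' : operator_le e (operator_abs e (rotation e T 0)) (modulus e T).
    by apply: ubM; exists 0 => //=; rewrite lexx mulr_ge0 ?pi_ge0.
  apply: (operator_le_trans He) h'; apply: (operator_le_trans He) h => x cx.
  by rewrite rot0 subr0.
have M0 x : real_span e x -> modulus e T x = 0.
  have [hM cv] := regular_has_matrix He rM.
  move=> hx; apply: (real_ext He) => [||m]; [exact: rop_real|exact: real_span0|].
  have A0 m' l : rc e m' (modulus e T (nb e l)) = 0.
    apply/eqP; rewrite eq_le.
    have := operator_le_entry He Mle m' l; have := operator_le_entry He Mge m' l.
    by rewrite /rc nc0 //= => -> ->.
  have := cv x m hx; under eq_fun do under eq_bigr do rewrite A0 mul0r.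
  under eq_fun do rewrite big1 //.
  move=> h; rewrite {2}/rc nc0 //=; apply: (cvg_unique _ h) => //; exact: cvg_cst.
apply: opnorm_on_le => [|x hx _]; first exact: real_span0.
by rewrite M0 // rnorm0.
Qed.

Lemma band_regular_roe b : band_operator d e b -> regular_roe d e b.
Proof.
move=> hb; have rb := band_regular hb; split=> // eps e0.
exists b => //; apply: le_lt_trans e0; apply: regular_norm_eq0 => [|x].
  exact: regular_operatorB.
by rewrite !fctE subrr.
Qed.

(* Schur multiplication by a kernel bounded by [1] is contractive up to the
   factor [2] for the regular norm. *)
Lemma schur_bound T W (C : R) : regular_operator e T -> regular_norm e T <= C -> 0 <= C ->
  bounded_linear W ->
  (forall m l, cabs (nc e m (W (nb e l))) <= cabs (nc e m (T (nb e l)))) ->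
  forall x, rnorm (W x) <= 2 * C * rnorm x.
Proof.
move=> rT TC C0 bW hWT x; have lW : linear W by case: bW.
apply: (tends_le (bounded_linear_tends bW (nc_expand He x))) => N /=.
(* Replacing the coordinates of [x] by their moduli makes the truncations positive, as
   [regular_norm_dominates] requires, without changing norms. *)
have [y [hy cy ny]] := abs_vector He x.
have ry := cone_real He cy.
have [z nz hz] := regular_norm_dominates He N rT (fun l => (proj2 ((coneP He y).1 cy)) l).
apply: (@le_trans _ _ (rnorm (2%:C *: z))); last first.
  rewrite rnormZ cabsR ger0_norm // -mulrA ler_pM2l //; apply: le_trans nz _.
  have -> : \sum_(0 <= l < N) (rc e l y)%:C *: nb e l = \sum_(0 <= l < N) nc e l y *: nb e l.
    by apply: eq_bigr => l _; rewrite rcE.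
  apply: (@le_trans _ _ (C * rnorm (\sum_(0 <= l < N) nc e l y *: nb e l))).
    by rewrite ler_wpM2r ?rnorm_ge0.
  by rewrite ler_wpM2l // -ny partial_le.
apply: (nc_mono He) => m; rewrite lin_sum // nc_sum // ncZ // cabsM cabsR ger0_norm //.
apply: le_trans (hz m); apply: le_trans (cabs_sum _ _ _) _; apply: ler_sum => l _.
by rewrite (linZ _ _ lW) ncZ // !cabsM hy ler_wpM2l ?cabs_ge0.
Qed.

(** The Schur bound with trivial multiplier bounds the operator norm by twice the regular norm. *)
Lemma regular_roe_uniform_roe a : regular_roe d e a -> uniform_roe d e a.
Proof.
move=> [ra ha]; split=> [|eps e0]; first by case: ra.
have e4 : 0 < eps / 4 by lra.
have [b hb nab] := ha _ e4; exists b => //.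
have rT := regular_operatorB ra (band_regular hb).
have bT : bounded_linear (a - b) by apply/bounded_operatorP; case: rT.
have e2 : 0 <= 2 * (eps / 4) by lra.
have hT := schur_bound rT (ltW nab) (ltW e4) bT (fun m l => lexx _).
by apply: le_lt_trans (opnorm_le e2 hT) _; lra.
Qed.

(** For a band operator [b] close to [a], the error [a - c] is the Schur product of [1 - k] with
    [a - b] plus that with [b]. The first is small by [schur_bound], the second because [1 - k] is
    small on the band of [b]. *)
Lemma kernel_approximation a (eps : R) : approx_kernel d -> regular_roe d e a -> 0 < eps ->
  exists (c : E -> E) (k : nat -> nat -> R) (D : R),
  [/\ bounded_linear c, forall m l, 0 <= k m l <= 1, forall m l, D < d l m -> k m l = 0,
      forall m l, nc e m (c (nb e l)) = (k m l)%:C * nc e m (a (nb e l))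
    & forall x, rnorm (a x - c x) <= eps * rnorm x].
Proof.
move=> hk [ra ha] e0; have e3 : 0 < eps / 3 by lra.
have [b hb nab] := ha _ e3.
have [bb [s s0 hs]] := band_operator_entries He hb.
have [lb [Kb Kb0 hKb]] := bb.
have /bounded_operatorP ba : bounded_operator a by case: ra.
have [la [Ka Ka0 hKa]] := ba.
have rT := regular_operatorB ra (band_regular hb).
have [C1 C10 hC1] := band_matrix_operator He dM dU s.
have Kb1 : 0 < Kb + 1 by lra.
have CK : 0 < C1 * (Kb + 1) by rewrite mulr_gt0.
have s1 : 0 < s + 1 by lra.
(* The kernel estimate holds for distances strictly below the radius, so [s + 1] covers the closed
   band. The accuracy brings the Schur product of [1 - k] with [b] down to [eps / 3]. *)
have [k [D [k01 kD kr]]] := hk _ _ s1 (divr_gt0 e3 CK).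
have [C2 C20 hC2] := band_matrix_operator He dM dU D.
have [m l|m l h|c [lc bc ec]] := hC2 (fun m l => (k m l)%:C * nc e m (a (nb e l))) Ka.
- have /andP[h0 h1] := k01 m l; rewrite cabsM cabsR ger0_norm //.
  rewrite -[Ka]mul1r ler_pM ?cabs_ge0 //; exact: (entry_le He He).
- by rewrite kD ?rmorph0 ?mul0r // dist_sym.
set eps' := eps / 3 / (C1 * (Kb + 1)) in kr.
have eps'0 : 0 < eps' by rewrite divr_gt0.
have [m l|m l h|w [lw bw ew]] := hC1 (fun m l => (1 - k m l)%:C * nc e m (b (nb e l)))
    (eps' * Kb).
- have /andP[h0 h1] := k01 m l; rewrite cabsM cabsR ger0_norm ?subr_ge0 //.
  have [dl|dl] := leP (d l m) s; last by rewrite hs // cabs0 mulr0 mulr_ge0 // ltW.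
  apply: ler_pM; rewrite ?subr_ge0 ?cabs_ge0 //; last exact: (entry_le He He).
  by apply: kr; rewrite (dist_sym dM); lra.
- by rewrite hs // mulr0.
have hw x : rnorm (w x) <= eps / 3 * rnorm x.
  apply: le_trans (bw x) _; rewrite ler_wpM2r ?rnorm_ge0 //.
  have -> : eps / 3 = C1 * (eps' * (Kb + 1)).
    by rewrite /eps'; field; rewrite !gt_eqF.
  by rewrite ler_pM2l // ler_pM2l //; lra.
have bc' : bounded_linear c by split=> //; exists (C2 * Ka) => //; rewrite mulr_ge0 // ltW.
have bw' : bounded_linear w by split=> //; exists (eps / 3) => //; lra.
pose W := (a - c) - w.
have bW : bounded_linear W by do 2?apply: bounded_linear_sub.
have eW m l : nc e m (W (nb e l)) = (1 - k m l)%:C * nc e m ((a - b) (nb e l)).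
  rewrite /W !fctE /= !ncB // ec ew rmorphB rmorph1 /=; ring.
have hW x : rnorm (W x) <= 2 * (eps / 3) * rnorm x.
  apply: (schur_bound rT (ltW nab) (ltW e3) bW) => m l.
  have /andP[h0 h1] := k01 m l.
  by rewrite eW cabsM cabsR ger0_norm ?subr_ge0 // ler_piMl ?cabs_ge0 //; lra.
exists c, k, D; split=> // [m l h|x]; first by rewrite kD // dist_sym.
have -> : a x - c x = W x + w x by rewrite /W !fctE subrK.
by apply: le_trans (rnormD _ _) _; have := hW x; have := hw x; lra.
Qed.

End RegularRoe.

(** * Lower bounds for the entries of [U] and [V] *)

Section Ghost.
Context {R : realType} {E F : completeNormedModType R[i]}.
Variables (e : nat -> E) (f : nat -> F) (d del : nat -> nat -> R) (U : E -> F) (V : F -> E).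
Hypotheses (He : sym_basis e) (Hf : sym_basis f).
Hypotheses (dM : metric_on_nat d) (dU : uniformly_locally_finite d).
Hypotheses (delM : metric_on_nat del) (delU : uniformly_locally_finite del).
Hypothesis HU : spatial e f d del U V.
Hypothesis HA : approx_kernel del.

Local Notation ent := (fun m n l => ent2 e f U V m n n l).

Let bU : bounded_linear U. Proof. by case: HU => -[]. Qed.
Let bV : bounded_linear V. Proof. by case: HU => -[]. Qed.
Let UK : cancel U V. Proof. by case: HU. Qed.
Let lU : linear U. Proof. by case: bU. Qed.
Let lV : linear V. Proof. by case: bV. Qed.

(** Otherwise [U (nb e n)] is zero or the [n]-th coordinate vanishes on the range of [V]; either
    contradicts [V (U (nb e n)) = nb e n]. *)
Lemma entry_neq0 n : exists m l, 0 < cabs (ent m n l).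
Proof.
apply: contrapT => h.
have h0 m l : ent2 e f U V m n n l = 0.
  apply/eqP/negPn/negP => hn; apply: h; exists m, l.
  by rewrite lt_neqAle cabs_ge0 eq_sym cabs_eq0 hn.
have [m hm] : exists m, nc f m (U (nb e n)) != 0.
  apply: contrapT => hm; have U0 : U (nb e n) = 0.
    apply: (nc_ext Hf) => m; rewrite nc0 //; apply/eqP/negPn/negP => hn.
    by apply: hm; exists m.
  have := nb_norm He n; rewrite -[nb e n]UK U0 (lin0 lV) rnorm0 => /eqP.
  by rewrite eq_sym oner_eq0.
have v0 l : nc e n (V (nb f l)) = 0.
  by have /eqP := h0 m l; rewrite mulf_eq0 (negbTE hm) => /eqP.
have [N hN] := entry_expand Hf He (U (nb e n)) n bV ltr01.
have := hN N (leqnn N); rewrite big1 => [|l _]; last by rewrite v0 mulr0.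
by rewrite UK nc_nb // eqxx sub0r cabsN cabs1 ltxx.
Qed.

(** Each index up to [N] has a nonzero entry. An index all of whose entries lie below the least of
    these finitely many moduli must exceed [N]. *)
Lemma small_entries_cofinal (N : nat) (eps : R) : 0 < eps ->
  (forall del0 : R, 0 < del0 -> exists n, forall m l, cabs (ent m n l) < del0) ->
  exists2 n, (N < n)%N & forall m l, cabs (ent m n l) < eps.
Proof.
move=> e0 hs.
have [r [r0 re hr]] : exists r : R, [/\ 0 < r, r <= eps &
    forall n, (n <= N)%N -> exists m l, r <= cabs (ent m n l)].
  elim: N => [|N [r [r0 re hr]]].
    have [m [l h]] := entry_neq0 0.
    exists (Num.min eps (cabs (ent m 0%N l))); split; rewrite ?lt_min ?e0 //.
      by rewrite ge_min lexx.
    by move=> n; rewrite leqn0 => /eqP ->; exists m, l; rewrite ge_min lexx orbT.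
  have [m [l h]] := entry_neq0 N.+1.
  exists (Num.min r (cabs (ent m N.+1 l))); split; rewrite ?lt_min ?r0 //.
    by rewrite ge_min re.
  move=> n; rewrite leq_eqVlt => /orP[/eqP ->|].
    by exists m, l; rewrite ge_min lexx orbT.
  by rewrite ltnS => /hr[m' [l' h']]; exists m', l'; rewrite ge_min h'.
have [n hn] := hs r r0; exists n => [|m l]; last exact: lt_le_trans (hn m l) re.
rewrite ltnNge; apply/negP => /hr[m [l]].
by rewrite leNgt hn.
Qed.

(** When [l] is large and [m] stays within [D] of it, [m] is large too, where the coordinates of
    [U (nb e n)] are small. *)
Lemma entry_tail_in_band (n : nat) (D eps : R) : 0 < eps ->
  exists L, forall l, (L <= l)%N -> forall m, del l m <= D -> cabs (ent m n l) < eps.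
Proof.
move=> e0; have [_ [C C0 hC]] := bV; have C1 : 0 < C + 1 by lra.
have [M hM] := nc_tail Hf (U (nb e n)) (divr_gt0 e0 C1).
have /choice[B hB] : forall m, exists L, forall y, del m y <= D -> (y < L)%N.
  by move=> m; exact: ball_bounded.
exists (\max_(m < M) B m) => l hl m hm.
have Mm : (M <= m)%N.
  rewrite leqNgt; apply/negP => mM.
  have : (l < B m)%N by apply: hB; rewrite dist_sym.
  rewrite ltnNge => /negP; apply; apply: leq_trans hl.
  exact: (@leq_bigmax_cond _ xpredT (fun i : 'I_M => B i) (Ordinal mM) isT).
rewrite cabsM; have := hM m Mm; rewrite ltr_pdivlMr //; apply: le_lt_trans.
rewrite ler_wpM2l ?cabs_ge0 //.
by apply: le_trans (entry_le Hf He _ _ hC) _; lra.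
Qed.

Lemma kernel_vector (L : nat) (x : nat -> F) : exists v : 'I_L.+1 -> R[i],
  (exists i, v i != 0) /\
  forall l, (l < L)%N -> nc f l (\sum_(i < L.+1) v i *: x i) = 0.
Proof.
pose M : 'M[R[i]]_(L.+1, L) := \matrix_(i, l) nc f l (x i).
have kM : kermx M != 0.
  by rewrite -mxrank_eq0 mxrank_ker -lt0n subn_gt0 ltnS rank_leq_col.
exists (fun i => nz_row (kermx M) 0 i); split.
  have : nz_row (kermx M) != 0 by rewrite nz_row_eq0.
  apply: contraNP => h; apply/eqP/rowP => i; rewrite mxE; apply/eqP/negPn/negP => hn.
  by apply: h; exists i.
move=> l lL; have /sub_kermxP/rowP/(_ (Ordinal lL)) := nz_row_sub (kermx M).
rewrite !mxE nc_sum // => h; rewrite -[RHS]h; apply: eq_bigr => i _.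
by rewrite ncZ // mxE.
Qed.

Lemma spatial_entries_large : exists2 delta : R, 0 < delta &
  forall n, exists m l, delta <= cabs (ent m n l).
Proof.
apply: contrapT => hcon.
have hs (del0 : R) : 0 < del0 -> exists n, forall m l, cabs (ent m n l) < del0.
  move=> del0_gt0; apply: contrapT => h; apply: hcon; exists del0 => // n.
  apply: contrapT => hn; apply: h; exists n => m l; rewrite ltNge; apply/negP => hl.
  by apply: hn; exists m, l.
have pow0 k : 0 < 2 ^- k.+1 :> R by rewrite invr_gt0 exprn_gt0.
have [phi hphi] := @increasing_choice
  (fun _ k n => forall m l, cabs (ent m n l) < 2 ^- k.+1)
  (fun N k => small_entries_cofinal N (pow0 k) hs).
(* The smallness granted at stage [k] concerns [phi k.+1], hence the shift. *)
pose nu k := phi k.+1.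
have mnu : {mono nu : i j / (i < j)%N}.
  by apply: increasing_homo => k; exact: (hphi k.+1).1.
have nuI : injective nu by apply: incn_inj; exact: leq_mono_ltn.
have small m l k : cabs (ent m (nu k) l) < 2 ^- k.+1 by exact: (hphi k).2.
have [p [hp tp pnb]] := partial_translation He dM dU mnu mnu
  (fun k => eq_ind_r (fun r : R => r <= 0) (lexx 0) (dist_refl dM (nu k))).
have [_ _ _ _ hreg] := HU.
have ra := hreg p (band_regular_roe He dM dU hp).
set a := U \o p \o V in ra.
(* One quarter is spent on replacing [a] by [c], another on the columns of [c] from [L] on: [eta] is
   chosen so that a matrix of width [D] with entries up to [eta] has norm at most 1/4. *)
have e4 : 0 < 1 / 4 :> R by lra.
have [c [k [D [bc k01 kD ec hc]]]] := kernel_approximation Hf delM delU HA ra e4.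
have [C C0 hC] := band_matrix_operator Hf delM delU D.
set eta := 1 / 4 / C.
have eta0 : 0 < eta by rewrite divr_gt0.
(* An entry of [a] is a series over [nu]. Its first [J] terms are small in distant columns of the
   band by [entry_tail_in_band], the others by the geometric choice of [nu]. *)
have [L hL] : exists L, forall l, (L <= l)%N -> forall m, del l m <= D ->
    cabs (nc f m (a (nb f l))) <= eta.
  have eta4 : 0 < eta / 4 by lra.
  have [J /(_ J (leqnn J)) hJ] := exp2_lt eta4.
  have J1 : 0 < J.+1%:R :> R by rewrite ltr0n.
  have /choice[L hL] : forall j, exists L, forall l, (L <= l)%N -> forall m, del l m <= D ->
      cabs (ent m (nu j) l) < eta / 4 / J.+1%:R.
    by move=> j; apply: entry_tail_in_band; rewrite divr_gt0.
  exists (\max_(j < J) L j) => l hl m hm.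
  have [K hK] := ent2_series Hf HU tp m l eta4.
  have JK := leq_maxr K J; have := hK _ (leq_maxl K J).
  set K' := maxn K J in JK *; rewrite (big_cat_nat (leq0n J) JK) /=.
  set A := nc f m _; set S1 := \sum_(0 <= _ < _) _; set S2 := \sum_(J <= _ < _) _ => h1.
  have h2 : cabs S1 <= eta / 4.
    apply: le_trans (cabs_sum _ _ _) _.
    apply: (@le_trans _ _ (\sum_(0 <= j < J) eta / 4 / J.+1%:R)).
      rewrite !big_mkord; apply: ler_sum => j _; apply: ltW; apply: hL => //.
      apply: leq_trans hl.
      exact: (@leq_bigmax_cond _ xpredT (fun i : 'I_J => L i) j isT).
    rewrite big_mkord sumr_const card_ord -[_ *+ J]mulr_natr.
    apply: (@le_trans _ _ (eta / 4 / J.+1%:R * J.+1%:R)).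
      by rewrite ler_wpM2l ?ler_nat // ltW // divr_gt0.
    by rewrite mulfVK ?gt_eqF.
  have h3 : cabs S2 <= eta / 4.
    apply: le_trans (cabs_sum _ _ _) _; apply: le_trans (ltW hJ).
    apply: (@le_trans _ _ (\sum_(J <= j < K') 2 ^- j.+1)).
      by apply: ler_sum => j _; apply: ltW; exact: small.
    have := sum_geometric (R := R) K'; rewrite (big_cat_nat (leq0n J) JK) /= sum_geometric.
    have : 0 <= 2 ^- K' :> R by rewrite invr_ge0 exprn_ge0.
    by set q := \sum_(_ <= _ < _) _; lra.
  have -> : A = (A - (S1 + S2)) + (S1 + S2) by rewrite subrK.
  apply: le_trans (cabsD _ _) _; have := cabsD S1 S2.
  by move: h1; rewrite /S1 /S2 /A; lra.
(* [T] is [c] with its first [L] columns removed; the two agree on vectors whose first [L]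
   coordinates vanish. *)
have [m l|m l h|T [lT bT eT]] := hC (fun m l => if (L <= l)%N
    then (k m l)%:C * nc f m (a (nb f l)) else 0) eta.
- case: ifP => [Ll|_]; last by rewrite cabs0 ltW.
  have /andP[h0 h1] := k01 m l; rewrite cabsM cabsR ger0_norm //.
  have [dl|dl] := leP (del l m) D; last by rewrite kD // mul0r ltW.
  by rewrite -[eta]mul1r ler_pM ?cabs_ge0 //; exact: hL.
- by rewrite kD // rmorph0 mul0r if_same.
have CE : C * eta = 1 / 4 by rewrite /eta; field; rewrite gt_eqF.
have bT' : bounded_linear T by split=> //; exists (C * eta) => //; rewrite CE; lra.
have agree y : (forall l, (l < L)%N -> nc f l y = 0) -> c y = T y.
  move=> y0; apply/eqP; rewrite -subr_eq0; apply/eqP/(nc_ext Hf) => m; rewrite nc0 //.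
  have bW := bounded_linear_sub bc bT'.
  apply/eqP; rewrite -cabs_eq0 eq_le cabs_ge0 andbT; apply/ler_addgt0Pr => eps e0.
  have [N hN] := entry_expand Hf Hf y m bW e0.
  have := hN N (leqnn N); rewrite big1; first by rewrite sub0r cabsN add0r => /ltW.
  move=> l _; have [lL|lL] := ltnP l L; first by rewrite y0 // mul0r.
  by rewrite !fctE ncB // ec eT lL subrr mulr0.
(* The resulting [x] is nonzero and fixed by [p], so [a] fixes [U x], while [c] and [T] agree
   there. *)
have [v [[i vi] hv]] := kernel_vector L (fun k => U (nb e (nu k))).
pose x := \sum_(i < L.+1) v i *: nb e (nu i).
have lp : linear p by case: hp => -[].
have px : p x = x.
  by rewrite /x (lin_sum _ _ _ lp); apply: eq_bigr => j _; rewrite (linZ _ _ lp) pnb.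
have Ux : U x = \sum_(i < L.+1) v i *: U (nb e (nu i)).
  by rewrite /x (lin_sum _ _ _ lU); apply: eq_bigr => j _; rewrite (linZ _ _ lU).
have aU : a (U x) = U x by rewrite /a /= UK px.
have cT : c (U x) = T (U x) by apply: agree => l lL; rewrite Ux hv.
have U0 : U x = 0.
  apply/eqP; rewrite -rnorm_eq0 eq_le rnorm_ge0 andbT.
  have := hc (U x); have := bT (U x); rewrite aU cT CE.
  have := rnormD (U x - T (U x)) (T (U x)); rewrite subrK.
  by lra.
have x0 : x = 0 by rewrite -[x]UK U0 lin0.
have := vi; have : nc e (nu i) x = v i.
  rewrite /x nc_sum // (bigD1 i) //= ncZ // nc_nb // eqxx mulr1 big1 ?addr0 // => j ji.
  by rewrite ncZ // nc_nb // (inj_eq nuI) eq_sym (inj_eq val_inj) (negbTE ji) mulr0.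
by rewrite x0 nc0 // => <-; rewrite eqxx.
Qed.

End Ghost.

(** * Spatial implementation *)

Section RankOne.
Context {R : realType} {E : completeNormedModType R[i]}.
Variables (e : nat -> E) (d : nat -> nat -> R).
Hypotheses (He : sym_basis e) (dM : metric_on_nat d).

Lemma rank1_le n (y x : E) : rnorm (nc e n x *: y) <= rnorm y * rnorm x.
Proof. by rewrite rnormZ mulrC ler_wpM2l ?rnorm_ge0 ?nc_le. Qed.

(** Truncating [y] in norm leaves an operator whose matrix has finitely many nonzero entries, all in
    column [n]. *)
Lemma rank1_uniform_roe n (y : E) : uniform_roe d e (fun x => nc e n x *: y).
Proof.
have bl z : bounded_linear (fun x => nc e n x *: z).
  by exact: rank1_bounded.
split=> [|eps e0]; first exact/bounded_operatorP.
have [N /(_ N (leqnn N)) hN] := nc_expand He y e0.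
set yN := \sum_(0 <= i < N) nc e i y *: nb e i in hN.
exists (fun x => nc e n x *: yN).
  (* The sum exceeds each distance from [n] to an index below [N], where the truncation is
     supported. *)
  apply: (band_operatorP He (s := \sum_(i < N) d n i)) => // m l h.
  rewrite ncZ // nc_nb //; have [nl|] := eqVneq n l; last by rewrite mul0r.
  rewrite mul1r nc_partial //; case: ltnP => // mN; move: h; rewrite -nl ltNge.
  rewrite (bigD1 (Ordinal mN)) //= lerDl => /negP[].
  by apply: sumr_ge0 => i _; exact: dist_ge0.
apply: le_lt_trans hN; rewrite rnormC; apply: opnorm_le; first exact: rnorm_ge0.
by move=> x; rewrite !fctE -scalerBr rank1_le.
Qed.

End RankOne.

Section Isomorphism.
Context {R : realType} {E F : completeNormedModType R[i]}.
Variables (e : nat -> E) (f : nat -> F) (d del : nat -> nat -> R).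
Hypotheses (He : sym_basis e) (Hf : sym_basis f).
Hypotheses (dM : metric_on_nat d) (dU : uniformly_locally_finite d).
Hypotheses (delM : metric_on_nat del) (delU : uniformly_locally_finite del).
Variable Phi : (E -> E) -> (F -> F).
Hypothesis HPhi : banach_algebra_isomorphism (uniform_roe d e) (uniform_roe del f) Phi.
Hypothesis HPhir : Phi @` regular_roe d e = regular_roe del f.

(* Writing [th x] for the rank-one operator [z |-> nc e 0 z *: x], put
   [U x = Phi (th x) y0] where [y0] lies in the range of the idempotent
   [Phi (th (nb e 0))]; the inverse of [U] comes from the preimages of the
   operators [z |-> nc f m z *: y] with [nc f m y0 != 0]. *)
Lemma isomorphism_spatial : exists (U : E -> F) (V : F -> E),
  spatial e f d del U V /\ spatial f e del d V U.
Proof.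
have [[funP injP surjP] linP mulP [M hM]] := HPhi.
pose A := uniform_roe d e; pose B := uniform_roe del f.
have bA a : A a -> bounded_linear a by exact: uniform_roe_bounded.
have bB b : B b -> bounded_linear b by exact: uniform_roe_bounded.
have lA a : A a -> linear a by move=> /bA[].
have lB b : B b -> linear b by move=> /bB[].
have PB a : A a -> B (Phi a) by move=> Aa; exact: funP.
pose th (x : E) : E -> E := fun z => nc e 0 z *: x.
have Ath x : A (th x) by exact: rank1_uniform_roe.
have thlin c x y : th (c *: x + y) = c *: th x + th y.
  by apply/funext => z; rewrite /th !fctE scalerDr !scalerA mulrC.
have thcomp a x : A a -> a \o th x = th (a x).
  by move=> /lA la; apply/funext => z; rewrite /th /= (linZ _ _ la).
have Phi0 : Phi (th 0) = 0.
  have := linP (-1) (th 0) (th 0) (Ath 0) (Ath 0).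
  by rewrite -thlin scaler0 addr0 scaleN1r addNr.
have opth x : opnorm (th x) <= rnorm x.
  by apply: opnorm_le => [|z]; [exact: rnorm_ge0|exact: rank1_le].
have opth0 x : 0 <= opnorm (th x).
  have := opnorm_ge (nb e 0%N) (bA _ (Ath x)); rewrite nb_norm // mulr1.
  by apply: le_trans; exact: rnorm_ge0.
pose q := th (nb e 0%N).
have qq : q \o q = q.
  by rewrite /q thcomp // /th nc_nb // eqxx scale1r.
have [y1 hy1] : exists y1, Phi q y1 != 0.
  apply: contrapT => h; have q0 : q = th 0.
    apply: injP; rewrite ?inE //; first exact: Ath.
      exact: Ath.
    rewrite Phi0; apply/funext => y; apply/eqP/negPn/negP => hn.
    by apply: h; exists y.
  have := congr1 (fun g => nc e 0 (g (nb e 0%N))) q0.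
  rewrite /q /th nc_nb // eqxx scale1r nc_nb // scale1r nc0 // eqxx => /eqP.
  by rewrite oner_eq0.
(* This nonzero vector is fixed by the idempotent [Phi q], whence [U (nb e 0) = y0]. *)
pose y0 := Phi q y1.
have Py0 : Phi q y0 = y0.
  by rewrite /y0 -[LHS]/((Phi q \o Phi q) y1) -mulP ?qq //; exact: Ath.
pose U x := Phi (th x) y0.
have lU : linear U.
  by move=> c x y; rewrite /U thlin linP //; exact: Ath.
have bU : bounded_linear U.
  split=> //; exists (`|M| * rnorm y0) => [|x]; first by rewrite mulr_ge0 ?rnorm_ge0.
  apply: le_trans (opnorm_ge _ (bB _ (PB _ (Ath x)))) _.
  rewrite mulrAC ler_wpM2r ?rnorm_ge0 //.
  have [h _] := hM _ (Ath x); apply: le_trans h _.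
  apply: le_trans (ler_wpM2r (opth0 x) (ler_norm M)) _.
  by rewrite ler_wpM2l.
(* [U] intertwines [a] and [Phi a]; injectivity, the inverse and [Phi a = U \o a \o V] are all read
   off from this identity. *)
have Uint a x : A a -> Phi a (U x) = U (a x).
  by move=> Aa; rewrite /U -thcomp // mulP //; exact: Ath.
have Ue : U (nb e 0%N) = y0 by exact: Py0.
have Uinj x : U x = 0 -> x = 0.
  move=> Ux; apply: (nc_ext He) => n; rewrite nc0 //.
  (* The image of this operator sends [U x] to [nc e n x *: y0], which detects the [n]-th
     coordinate. *)
  have Ab : A (fun z => nc e n z *: nb e 0%N) by exact: rank1_uniform_roe.
  have := Uint _ x Ab; rewrite Ux (lin0 (lB _ (PB _ Ab))) (linZ _ _ lU) Ue.
  by move/esym/eqP; rewrite scaler_eq0 (negbTE hy1) orbF => /eqP.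
have UI x x' : U x = U x' -> x = x'.
  by move=> h; apply/eqP; rewrite -subr_eq0; apply/eqP/Uinj; rewrite (linB _ _ lU) h subrr.
have [m hm] : exists m, nc f m y0 != 0.
  apply: contrapT => h; move/eqP: hy1; apply; apply: (nc_ext Hf) => m.
  by rewrite nc0 //; apply/eqP/negPn/negP => hn; apply: h; exists m.
have Bth y : B (fun z => nc f m z *: y) by exact: rank1_uniform_roe.
have /choice[G hG] : forall y, exists a, A a /\ Phi a = (fun z => nc f m z *: y).
  by move=> y; have [a Aa ha] := surjP _ (Bth y); exists a.
(* By [Uint], [U] maps [G y (nb e 0)] to [nc f m y0 *: y], which explains the scalar. *)
pose V y := (nc f m y0)^-1 *: G y (nb e 0%N).
have VK : cancel V U.
  move=> y; have [Aa ha] := hG y; rewrite /V (linZ _ _ lU) -Uint // ha Ue scalerA.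
  by rewrite mulVf // scale1r.
have UK : cancel U V by move=> x; apply: UI; rewrite VK.
have lV : linear V by move=> c x y; apply: UI; rewrite VK lU !VK.
have bV : bounded_linear V.
  split=> //; exists (cabs (nc f m y0)^-1 * `|M|) => [|y]; first by rewrite mulr_ge0 ?cabs_ge0.
  have [Aa ha] := hG y; rewrite /V rnormZ -mulrA ler_wpM2l ?cabs_ge0 //.
  have := opnorm_ge (nb e 0%N) (bA _ Aa); rewrite nb_norm // mulr1 => h; apply: le_trans h _.
  have [_ h] := hM _ Aa; apply: le_trans h _; rewrite ha.
  have o1 : opnorm (fun z => nc f m z *: y) <= rnorm y.
    by apply: opnorm_le => [|z]; [exact: rnorm_ge0|exact: rank1_le].
  have o0 : 0 <= opnorm (fun z => nc f m z *: y).
    have := opnorm_ge (nb f m) (bB _ (Bth y)); rewrite nb_norm // mulr1.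
    by apply: le_trans; exact: rnorm_ge0.
  apply: le_trans (ler_wpM2r o0 (ler_norm M)) _.
  by rewrite ler_wpM2l.
have PhiE a : A a -> Phi a = U \o a \o V.
  by move=> Aa; apply/funext => y; rewrite /= -Uint // VK.
have PhiV a : A a -> V \o Phi a \o U = a.
  by move=> Aa; rewrite PhiE //; apply/funext => x; rewrite /= !UK.
exists U, V; split; split=> //.
- by move=> a Aa; rewrite -PhiE //; exact: PB.
- move=> a ra; have Aa : A a by exact: regular_roe_uniform_roe.
  by rewrite -PhiE // -HPhir; exists a.
- by move=> b Bb; have [a Aa <-] := surjP _ Bb; rewrite PhiV.
- rewrite -HPhir => _ [a ra <-].
  by rewrite PhiV //; exact: regular_roe_uniform_roe.
Qed.

End Isomorphism.

(** * From large entries to a coarse equivalence *)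

Section CoarseEquivalence.
Context {R : realType}.

(** Both factors of a large product are at most [K], so each is at least [delta / K]. Separate
    bounds allow the factor of one index to be paired with that of another. *)
Lemma spatial_factors (E F : completeNormedModType R[i]) (e : nat -> E) (f : nat -> F)
    (d del : nat -> nat -> R) (U : E -> F) (V : F -> E) :
  sym_basis e -> sym_basis f -> metric_on_nat d -> uniformly_locally_finite d ->
  metric_on_nat del -> uniformly_locally_finite del ->
  spatial e f d del U V -> approx_kernel del ->
  exists2 alpha : R, 0 < alpha & exists g h : nat -> nat, forall n,
    alpha <= cabs (nc f (g n) (U (nb e n))) /\ alpha <= cabs (nc e n (V (nb f (h n)))).
Proof.
move=> He Hf dM dU delM delU HU HA.
have [delta d0 hd] := spatial_entries_large He Hf dM dU delM delU HU HA.
have /choice[p hp] : forall n, exists p : nat * nat, delta <= cabs (ent2 e f U V p.1 n n p.2).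
  by move=> n; have [m [l h]] := hd n; exists (m, l).
have [[[_ [C C0 hC]] [_ [D D0 hD]]] _ _ _ _] := HU.
set K := C + D + 1; have K0 : 0 < K by rewrite /K; lra.
exists (delta / K); first by rewrite divr_gt0.
exists (fun n => (p n).1), (fun n => (p n).2) => n.
have := hp n; rewrite cabsM; set u := cabs _; set v := cabs _ => huv.
have uK : u <= K by apply: le_trans (entry_le He Hf _ _ hC) _; rewrite /K; lra.
have vK : v <= K by apply: le_trans (entry_le Hf He _ _ hD) _; rewrite /K; lra.
rewrite !ler_pdivrMr //; split; apply: le_trans huv _.
  by rewrite ler_wpM2l ?cabs_ge0.
by rewrite mulrC ler_wpM2l ?cabs_ge0.
Qed.

Lemma spatial_coarsely_equivalent (E F : completeNormedModType R[i])
    (e : nat -> E) (f : nat -> F) (d del : nat -> nat -> R) (U : E -> F) (V : F -> E) :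
  sym_basis e -> sym_basis f -> metric_on_nat d -> uniformly_locally_finite d ->
  metric_on_nat del -> uniformly_locally_finite del ->
  spatial e f d del U V -> spatial f e del d V U -> approx_kernel del ->
  coarsely_equivalent d del.
Proof.
move=> He Hf dM dU delM delU HU HV HA.
have [al al0 [g [h hgh]]] := spatial_factors He Hf dM dU delM delU HU HA.
have al2 : 0 < al * al by rewrite mulr_gt0.
have fwd (r eta : R) : 0 < eta -> exists2 s : R, 0 < s & forall m n n' l, d n n' <= r ->
    eta <= cabs (nc f m (U (nb e n))) * cabs (nc e n' (V (nb f l))) -> del l m < s.
  move=> eta0; have [s hs] := spatial_entries_band He Hf dM dU HU r eta0.
  exists (`|s| + 1) => [|m n n' l dn he]; first by have := normr_ge0 s; lra.
  rewrite ltNge; apply/negP => hlt.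
  have sl : s < del l m by have := ler_norm s; lra.
  by have := hs m n n' l dn sl; rewrite cabsM ltNge he.
(* Here the matrix unit joins [h a] and [g b] on the side of [F], and its image under the inverse
   isomorphism has a large entry at [a] and [b]. *)
have bwd (r : R) : exists2 s : R, 0 < s & forall a b, del (h a) (g b) <= r -> d b a < s.
  have [s hs] := spatial_entries_band Hf He delM delU HV r al2.
  exists (`|s| + 1) => [|a b hab]; first by have := normr_ge0 s; lra.
  rewrite ltNge; apply/negP => hlt.
  have sl : s < d b a by have := ler_norm s; lra.
  have [_ ha] := hgh a; have [hb _] := hgh b.
  by have := hs a (h a) (g b) b hab sl; rewrite cabsM ltNge ler_pM // ltW.
(* Radius 0 pairs the two factors of a single index and shows that [g] and [h] stay at bounded
   distance. *)
have [s0 s00 hs0] := fwd 0 _ al2.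
have hg n : del (h n) (g n) < s0.
  have [h1 _] := hgh n; have [_ h2] := hgh n.
  by apply: (hs0 _ n n); rewrite ?dist_refl // ler_pM // ltW.
have emb : coarse_embedding d del h.
  split=> [r r0|s sp].
    have [s1 s10 hs1] := fwd r _ al2.
    exists (s0 + s1); first by rewrite addr_gt0.
    (* The factor of [x] in [U] and that of [y] in [V] bring [g x] close to [h y]; and [h x] is
       close to [g x]. *)
    move=> x y /ltW dxy; apply: le_lt_trans (dist_tri delM _ (g x) _) _.
    apply: ltrD => //; rewrite dist_sym //.
    have [h1 _] := hgh x; have [_ h2] := hgh y.
    by apply: (hs1 _ x y) => //; rewrite ler_pM // ltW.
  have [t t0 ht] := bwd (s + s0).
  exists t => // x y txy; rewrite ltNge; apply/negP => hle.
  suff /ht : del (h y) (g x) <= s + s0 by rewrite ltNge (ltW txy).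
  apply: le_trans (dist_tri delM _ (h x) _) _.
  by rewrite lerD ?(ltW (hg x)) // dist_sym.
exists h; split=> //.
(* The lower bound for the inverse isomorphism needs the kernels for [d]. It gives [x = g' y] such
   that [V (nb f y)] has a large coordinate at [x]; as [U (nb e x)] has one at [g x], the point [y]
   is close to [g x], hence to [h x]. *)
have HA' := approx_kernel_pullback emb HA.
have [be be0 [g' [h' hgh']]] := spatial_factors Hf He delM delU dM dU HV HA'.
have ab0 : 0 < al * be by rewrite mulr_gt0.
have [s3 s30 hs3] := fwd 0 _ ab0.
exists (s3 + s0) => y.
pose x := g' y.
apply: (@le_trans _ _ (del y (h x))).
  apply: ge_inf; last by exists x.
  by exists 0 => _ [z _ <-]; exact: dist_ge0.
apply: le_trans (dist_tri delM _ (g x) _) _; apply: lerD; last first.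
  by rewrite dist_sym // ltW.
apply: ltW; have [h1 _] := hgh x; have [h2 _] := hgh' y.
by apply: (hs3 _ x x); rewrite ?dist_refl // ler_pM // ltW.
Qed.

End CoarseEquivalence.

Theorem theorem1p7 (R : realType) (d del : nat -> nat -> R)
    (E F : completeNormedModType R[i]) (e : nat -> E) (f : nat -> F) :
  metric_on_nat d -> metric_on_nat del ->
  uniformly_locally_finite d -> uniformly_locally_finite del ->
  schauder_basis e -> unconditional1 e -> symmetric_basis e ->
  schauder_basis f -> unconditional1 f -> symmetric_basis f ->
  property_A del ->
  (exists Phi : (E -> E) -> (F -> F),
     banach_algebra_isomorphism (uniform_roe d e) (uniform_roe del f) Phi /\
     Phi @` regular_roe d e = regular_roe del f) ->
  coarsely_equivalent d del.
Proof.
move=> dM delM dU delU e1 e2 e3 f1 f2 f3 HA [Phi [HPhi HPhir]].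
have He : sym_basis e by split.
have Hf : sym_basis f by split.
have [U [V [HU HV]]] := isomorphism_spatial He Hf dM dU delM HPhi HPhir.
exact: spatial_coarsely_equivalent He Hf dM dU delM delU HU HV (property_A_kernel HA).
Qed.
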